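(* Let $G=F_2=\langle a,b\rangle$ be the free group of rank $2$ with free basis $a,b$. Then for all integers $k,n\neq 0$, the element $w=a^kb^n$ generates a measure free factor of $G$, i.e. the cyclic subgroup $\langle w\rangle$ is a measure free factor of $G$.
   Context: A Borel action $G\curvearrowright X$ of a group on a standard Borel probability space $(X,\mu)$ is p.m.p. if $G$ acts by $\mu$-preserving Borel automorphisms, and it is free if the set of $x\in X$ with $g\cdot x=x$ for some non-trivial $g\in G$ has measure zero. For a subgroup $H\le G$, $E_H^X$ denotes the equivalence relation on $X$ whose classes are the $H$-orbits. A Borel equivalence relation on $X$ is an equivalence relation that is a Borel subset of $X\times X$. Two Borel equivalence relations $E_1,E_2$ on a standard Borel space are orthogonal, written $E_1\perp E_2$, if for every $n\ge 1$ and every cycle $(x_i)_{i\in\mathbb{Z}_{2n}}$ of points with $(x_i,x_{i+1})\in E_1$ for all odd $i$ and $(x_i,x_{i+1})\in E_2$ for all even $i$, one has $x_i=x_{i+1}$ for some $i$. A measure preserving Borel equivalence relation $E$ is the free product of Borel sub-equivalence relations $E_1,E_2$, written $E=E_1*E_2$, if $E$ is generated by $E_1\cup E_2$ and there is a full measure set $B$ such that $E_1|_B\perp E_2|_B$, where $E_i|_B=E_i\cap(B\times B)$. A subgroup $H\le G$ is a measure free factor of $G$ if there exist a free p.m.p. Borel action $G\curvearrowright X$ on a standard Borel probability space and a Borel equivalence relation $E'$ on $X$ such that $E_G^X=E_H^X*E'$. *)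

(* Defs.v *)
From HB Require Import structures.
From mathcomp Require Import all_boot all_order all_algebra.
From mathcomp Require Import all_classical all_reals all_analysis.

Set Implicit Arguments.
Unset Strict Implicit.
Unset Printing Implicit Defensive.

Import Order.TTheory GRing.Theory Num.Theory.

Local Open Scope classical_set_scope.
Local Open Scope ring_scope.

(** * Groups: integer powers, subgroups, free bases *)

Definition expgz (G : groupType) (x : G) (m : int) : G :=
  match m with
  | Posz n => (x ^+ n)%g
  | Negz n => (x ^- n.+1)%g
  end.

Definition is_subgroup (G : groupType) (H : set G) : Prop :=
  H 1%g /\ (forall x y, H x -> H y -> H (x / y)%g).

Definition cyclic_subgroup (G : groupType) (x : G) : set G :=
  range (expgz x).

(** The letter [(i, false)] stands for the generator [e i] and [(i, true)] for
    its inverse. *)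
Definition word (I : Type) : Type := seq (I * bool).

Definition reduced (I : eqType) (u : word I) : bool :=
  sorted (fun s t => ~~ ((s.1 == t.1) && (s.2 != t.2))) u.

Definition word_eval (I : Type) (G : groupType) (e : I -> G) (u : word I) : G :=
  (\prod_(s <- u) (if s.2 then (e s.1)^-1 else e s.1))%g.

Definition free_basis (I : eqType) (G : groupType) (e : I -> G) : Prop :=
  forall g : G, exists! u : word I, reduced u /\ word_eval e u = g.

Definition free_basis2 (G : groupType) (a b : G) : Prop :=
  free_basis (fun i : bool => if i then b else a).

(** * Standard Borel spaces and p.m.p. actions *)

(** The sigma-algebra of [X] is the Borel sigma-algebra of a Polish topology,
    the latter being carried by a copy [P] of the underlying set of [X]. For a
    pseudometric space, "Hausdorff" means that the pseudometric separates
    points. *)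
Definition standard_borel (R : realType) (d : measure_display)
    (X : measurableType d) : Prop :=
  exists (P : completePseudoMetricType R) (f : X -> P),
    [/\ hausdorff_space P, @second_countable P, bijective f &
        @measurable d X = [set f @^-1` B | B in <<s @open P >>]].

Definition borel_automorphism (d : measure_display) (X : measurableType d)
    (f : X -> X) : Prop :=
  exists f' : X -> X, [/\ cancel f f', cancel f' f,
    measurable_fun [set: X] f & measurable_fun [set: X] f'].

Definition preserves (R : realType) (d : measure_display)
    (X : measurableType d) (mu : probability X R) (f : X -> X) : Prop :=
  forall A : set X, measurable A -> mu (f @^-1` A) = mu A.

Definition is_action (G : groupType) (X : Type) (act : G -> X -> X) : Prop :=
  (forall x, act 1%g x = x) /\
  (forall g h x, act (g * h)%g x = act g (act h x)).

Definition pmp_action (R : realType) (d : measure_display)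
    (X : measurableType d) (mu : probability X R)
    (G : groupType) (act : G -> X -> X) : Prop :=
  is_action act /\
  (forall g, borel_automorphism (act g) /\ preserves mu (act g)).

Definition free_action (R : realType) (d : measure_display)
    (X : measurableType d) (mu : probability X R)
    (G : groupType) (act : G -> X -> X) : Prop :=
  mu.-negligible [set x | exists2 g : G, g != 1%g & act g x = x].

(** * Borel equivalence relations *)

Definition equiv_relation (X : Type) (E : set (X * X)) : Prop :=
  [/\ forall x, E (x, x),
      forall x y, E (x, y) -> E (y, x) &
      forall x y z, E (x, y) -> E (y, z) -> E (x, z)].

Definition borel_equiv_relation (d : measure_display) (X : measurableType d)
    (E : set (X * X)) : Prop :=
  equiv_relation E /\ measurable E.

Definition orbit_relation (G : groupType) (X : Type) (act : G -> X -> X)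
    (H : set G) : set (X * X) :=
  [set xy | exists2 h, H h & act h xy.1 = xy.2].

Definition generated_equiv_relation (X : Type) (S : set (X * X)) :
    set (X * X) :=
  smallest (@equiv_relation X) S.

Definition restrict_relation (X : Type) (E : set (X * X)) (B : set X) :
    set (X * X) :=
  E `&` (B `*` B).

(** The cyclic index set Z/2n is ['I_n.*2], whose cyclic successor is [ordS]. *)
Definition orthogonal_relations (X : Type) (E1 E2 : set (X * X)) : Prop :=
  forall (n : nat) (x : 'I_n.*2 -> X), (1 <= n)%N ->
    (forall i : 'I_n.*2, odd i -> E1 (x i, x (ordS i))) ->
    (forall i : 'I_n.*2, ~~ odd i -> E2 (x i, x (ordS i))) ->
    exists i, x i = x (ordS i).

(** [E] is measure preserving if every element of its full group is. *)
Definition measure_preserving_relation (R : realType) (d : measure_display)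
    (X : measurableType d) (mu : probability X R) (E : set (X * X)) : Prop :=
  forall f : X -> X, borel_automorphism f -> (forall x, E (x, f x)) ->
    preserves mu f.

Definition free_product (R : realType) (d : measure_display)
    (X : measurableType d) (mu : probability X R)
    (E E1 E2 : set (X * X)) : Prop :=
  [/\ borel_equiv_relation E /\ measure_preserving_relation mu E,
      borel_equiv_relation E1, borel_equiv_relation E2,
      E = generated_equiv_relation (E1 `|` E2) &
      exists B : set X, [/\ measurable B, mu B = 1%E &
        orthogonal_relations (restrict_relation E1 B)
          (restrict_relation E2 B)]].

Definition measure_free_factor (R : realType) (G : groupType) (H : set G) :
    Prop :=
  is_subgroup H /\
  exists (d : measure_display) (X : measurableType d) (mu : probability X R)
      (act : G -> X -> X) (E' : set (X * X)),
    [/\ standard_borel R X, pmp_action mu act, free_action mu act &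
        free_product mu (orbit_relation act [set: G])
          (orbit_relation act H) E'].

(* Main.v *)
Require Import Defs.
From HB Require Import structures.
From mathcomp Require Import all_boot all_order all_algebra.
From mathcomp Require Import all_classical all_reals all_analysis.
From mathcomp Require Import archimedean zify.

Set Implicit Arguments.
Unset Strict Implicit.
Unset Printing Implicit Defensive.

Import Order.TTheory GRing.Theory Num.Theory.
Import numFieldNormedType.Exports.

Local Open Scope classical_set_scope.
Local Open Scope ring_scope.

(** After replacing a basis element by its inverse where needed, the word is
    [w = a ^ p * b ^ q] with [p, q > 0]. In a free orbit of [G], draw the edges
    [x -- a x] and [x -- b x]; they form a tree. Adding the edges [x -- w x],
    the orbit becomes the vertex set of a contractible complex that has one
    face for each point [y]: the polygon that runs from [b ^- q y] along [q]
    edges of type [b] to [y], then along [p] edges of type [a] to [a ^ p y], and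
    back along an edge of type [w].

    The idea is to let every face delete one of its [a]- or [b]-edges. A face [y]
    that picks [a] deletes its last [a]-edge, which starts at [a ^ (p - 1) y]; a
    face that picks [b] deletes its last [b]-edge, which ends at [y]. Let [E'] be
    generated by the [a]- and [b]-edges that are kept. Suppose that there is a
    rank function with values in [nat] such that every deleted edge on the
    boundary of [y], other than the one deleted by [y] itself, is deleted by a
    face of smaller rank. Then, by induction on the rank, the ends of each
    deleted edge are related by paths of kept edges and [w]-edges, so
    [E_G] is generated by [E_<w>] and [E'] ([orbit_relation_generated]). The
    same recursion labels the edges by elements of a free group on three
    letters [a], [b], [w]: kept edges get the letter of their type, and the
    label of a deleted edge is the one for which the labels around its face
    multiply to the letter [w] ([exists_labelling]). As [G] is free, these
    labels extend to a cocycle of the action. An alternating cycle of [E_<w>] and [E'] whose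
    consecutive points differ gives a nonempty reduced word in three letters
    that evaluates to [1], which is impossible; this proves orthogonality
    ([kept_relation_orthogonal]).

    It remains to find an action with such choices. The space consists of the
    families of digits in base [M = maxn p q + 1] that are indexed by
    [nat + nat * G], with the uniform product measure. On [nat * G] the group acts by shifting [G], which makes
    the action free almost everywhere. On a digit sequence [u], the generator
    [a] finds the first nonzero block [u_2i, u_(2i+1)], reads it as an integer
    between [1] and [M ^ 2 - 1], and adds one to it cyclically; [b] does the
    same with the blocks [u_(2i+1), u_(2i+2)], unless [u_0] is nonzero, in which
    case it fixes [u]. A point picks [a] when its first nonzero digit is in an
    even position and [b] when it is in an odd position. The position of the
    first nonzero digit, followed by the integer read there, is a suitable rank
    ([block_rank_iter_pred]): in an orbit of [a] only two successive positions
    occur, the earlier one belongs to the faces that pick [a], and these come in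
    runs that are separated by [M - 1] points that pick [b].

    The uniform measure is the image of Lebesgue measure on the unit interval
    under the expansion in base [M]. A bijection that matches cylinders with cylinders
    of the same length preserves it ([preserves_uniform]), which applies to
    both generators. *)

(** * Reduced words and the universal property of a free basis *)

#[local] Arguments reduced : simpl never.

Section ReducedWords.
Variable I : eqType.
Implicit Types (s : I * bool) (u v : word I).

Definition inv_letter s : I * bool := (s.1, ~~ s.2).

(** Left multiplication of a reduced word by a letter. *)
Definition push s u : word I :=
  if u is t :: u' then if t == inv_letter s then u' else s :: u else [:: s].

Lemma inv_letterK : involutive inv_letter.
Proof. by case=> i b; rewrite /inv_letter /= negbK. Qed.

Lemma reduced_cons s u :
  reduced (s :: u) =
  (if u is t :: _ then t != inv_letter s else true) && reduced u.
Proof.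
case: u => [|[j c] u] //=; case: s => i b; rewrite /reduced /=.
rewrite /inv_letter xpair_eqE /= (eq_sym j).
by case: (i == j); case: b; case: c.
Qed.

Lemma push_reduced s u : reduced u -> reduced (push s u).
Proof.
case: u => [|t u] //= ru; case: eqP => [_|/eqP ts].
  by move: ru; rewrite reduced_cons => /andP[].
by rewrite reduced_cons ts ru.
Qed.

Lemma pushK s u : reduced u -> push (inv_letter s) (push s u) = u.
Proof.
case: u => [|t u] /=; first by rewrite inv_letterK eqxx.
rewrite reduced_cons; case: eqP => [-> /andP[]|_ _] /=.
  by case: u => [|t' u] //= /negPf ->.
by rewrite inv_letterK eqxx.
Qed.

(** The reduced form of a word. *)
Definition reduce u : word I := foldr push [::] u.

Lemma reduce_reduced u : reduced (reduce u).
Proof. by elim: u => //= s u; exact: push_reduced. Qed.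

Lemma reduce_id u : reduced u -> reduce u = u.
Proof.
elim: u => //= s u IH; rewrite reduced_cons => /andP[su ru].
by rewrite IH //; case: u {IH ru} su => //= t u /negPf ->.
Qed.

Definition word_inv u : word I := rev (map inv_letter u).

(** The value of a single letter. *)
Definition letter_eval (G : groupType) (e : I -> G) s : G :=
  (if s.2 then (e s.1)^-1 else e s.1)%g.

Lemma letter_eval_inv (G : groupType) (e : I -> G) s :
  letter_eval e (inv_letter s) = ((letter_eval e s)^-1)%g.
Proof. by case: s => i [] /=; rewrite /letter_eval //= invgK. Qed.

Lemma word_eval_nil (G : groupType) (e : I -> G) : word_eval e [::] = 1%g.
Proof. by rewrite /word_eval big_nil. Qed.

Lemma word_eval_cons (G : groupType) (e : I -> G) s u :
  word_eval e (s :: u) = (letter_eval e s * word_eval e u)%g.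
Proof. by rewrite /word_eval big_cons. Qed.

Lemma word_eval_cat (G : groupType) (e : I -> G) u v :
  word_eval e (u ++ v) = (word_eval e u * word_eval e v)%g.
Proof. by rewrite /word_eval big_cat. Qed.

Lemma word_eval_push (G : groupType) (e : I -> G) s u :
  word_eval e (push s u) = (letter_eval e s * word_eval e u)%g.
Proof.
case: u => [|t u] /=; first by rewrite word_eval_cons.
case: eqP => [->|_]; rewrite !word_eval_cons //.
by rewrite letter_eval_inv mulVKg.
Qed.

Lemma word_eval_reduce (G : groupType) (e : I -> G) u :
  word_eval e (reduce u) = word_eval e u.
Proof. by elim: u => //= s u IH; rewrite word_eval_push IH word_eval_cons. Qed.

Lemma word_eval_inv (G : groupType) (e : I -> G) u :
  word_eval e (word_inv u) = ((word_eval e u)^-1)%g.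
Proof.
elim: u => [|s u IH]; first by rewrite word_eval_nil invg1.
rewrite /word_inv /= rev_cons -cats1 word_eval_cat -/(word_inv u) IH.
by rewrite !word_eval_cons word_eval_nil mulg1 letter_eval_inv invgM.
Qed.

Section WordAction.
Variables (Y : Type) (f f' : I -> Y -> Y).
Hypotheses (fK : forall i, cancel (f i) (f' i)).
Hypotheses (f'K : forall i, cancel (f' i) (f i)).

(** The action of a letter on a type where the generator [i] acts by [f i] and its
    inverse by [f' i]. *)
Definition letter_act s : Y -> Y := if s.2 then f' s.1 else f s.1.

Definition word_act u (y : Y) : Y := foldr letter_act y u.

Lemma letter_actK s : cancel (letter_act s) (letter_act (inv_letter s)).
Proof. by case: s => i [] y; rewrite /letter_act /= ?fK ?f'K. Qed.

Lemma word_act_push s u y : word_act (push s u) y = letter_act s (word_act u y).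
Proof.
case: u => [|t u] //=; case: eqP => [->|_] //=.
by rewrite -{1}(inv_letterK s) letter_actK.
Qed.

Lemma word_act_reduce u y : word_act (reduce u) y = word_act u y.
Proof. by elim: u => //= s u IH; rewrite word_act_push IH. Qed.

End WordAction.

Section FreeBasis.
Variables (G : groupType) (e : I -> G).
Hypothesis eF : free_basis e.

Lemma free_basis_word g : exists u, reduced u /\ word_eval e u = g.
Proof. by have [u [? _]] := eF g; exists u. Qed.

(** The reduced word representing a group element. *)
Definition word_of g : word I := projT1 (cid (free_basis_word g)).

Lemma word_of_reduced g : reduced (word_of g).
Proof. by rewrite /word_of; case: cid => u []. Qed.

Lemma word_ofK g : word_eval e (word_of g) = g.
Proof. by rewrite /word_of; case: cid => u []. Qed.

Lemma word_of_eval u : word_of (word_eval e u) = reduce u.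
Proof.
have [v [_ uv]] := eF (word_eval e u).
rewrite -(uv (word_of (word_eval e u))); last first.
  by split; [exact: word_of_reduced | exact: word_ofK].
by apply: uv; split; [exact: reduce_reduced | exact: word_eval_reduce].
Qed.

Section FreeAction.
Variables (Y : Type) (f f' : I -> Y -> Y).
Hypotheses (fK : forall i, cancel (f i) (f' i)).
Hypotheses (f'K : forall i, cancel (f' i) (f i)).

(** The action of [G] in which each basis element [e i] acts by [f i]; the
    family [f'] consists of the inverses. *)
Definition free_act (g : G) : Y -> Y := word_act f f' (word_of g).

Lemma free_act_eval u y : free_act (word_eval e u) y = word_act f f' u y.
Proof. by rewrite /free_act word_of_eval word_act_reduce. Qed.

Lemma free_act_is_action : is_action free_act.
Proof.
split=> [y|g h y]; first by rewrite -(word_eval_nil e) free_act_eval.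
rewrite -{1}(word_ofK g) -{1}(word_ofK h) -word_eval_cat free_act_eval.
by rewrite /word_act foldr_cat.
Qed.

Lemma free_act_basis i y : free_act (e i) y = f i y.
Proof.
have -> : e i = word_eval e [:: (i, false)].
  by rewrite word_eval_cons word_eval_nil mulg1.
exact: free_act_eval.
Qed.

End FreeAction.
End FreeBasis.
End ReducedWords.

(** Inverting some elements of a free basis yields a free basis. *)
Lemma free_basis_map (I : eqType) (G : groupType) (e e' : I -> G)
    (flip : I -> bool) :
  (forall i, e' i = if flip i then ((e i)^-1)%g else e i) ->
  free_basis e -> free_basis e'.
Proof.
move=> e'E eF.
pose phi (u : word I) : word I := [seq (s.1, s.2 (+) flip s.1) | s <- u].
have phiK : involutive phi.
  move=> u; rewrite /phi -map_comp -[RHS]map_id; apply: eq_map => -[i b] /=.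
  by rewrite -addbA addbb addbF.
have phi_red u : reduced (phi u) = reduced u.
  elim: u => //= s u IH; rewrite !reduced_cons -IH -/(phi u).
  case: u {IH} => //= t u; congr (_ && _); rewrite /inv_letter !xpair_eqE /=.
  move: s t => [i x] [j y] /=; rewrite [in RHS]xpair_eqE.
  by case: (j =P i) => [->|] //=; case: x; case: y; case: (flip _).
have phi_eval u : word_eval e' (phi u) = word_eval e u.
  rewrite /word_eval /phi big_map; apply: eq_bigr => -[i b] _ /=.
  by rewrite e'E; case: b; case: (flip i); rewrite //= ?invgK.
move=> g; have [u [[ru ug] uq]] := eF g.
exists (phi u); split; first by rewrite phi_red phi_eval.
move=> v [rv vg]; rewrite (uq (phi v)) ?phiK //.
by rewrite phi_red -phi_eval phiK.
Qed.

(** * The group of permutations of a type *)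

(** A bijection of [Y] onto itself, bundled with its inverse. *)
Record self_bij (Y : Type) := SelfBij {
  bij_fun : Y -> Y;
  bij_inv : Y -> Y;
  bij_funK : cancel bij_fun bij_inv;
  bij_invK : cancel bij_inv bij_fun }.

HB.instance Definition _ Y := gen_eqMixin (self_bij Y).
HB.instance Definition _ Y := gen_choiceMixin (self_bij Y).

Section SelfBijGroup.
Variable Y : Type.
Implicit Types f g h : self_bij Y.

Lemma self_bijP f g : bij_fun f = bij_fun g -> f = g.
Proof.
case: f g => f f' fK f'K [g g' gK g'K] /= fg.
have f'g' : f' = g' by apply/funext => y; rewrite -{1}(g'K y) -fg fK.
by subst g g'; congr SelfBij; exact: Prop_irrelevance.
Qed.

Definition bij_one : self_bij Y := @SelfBij Y id id (fun=> erefl) (fun=> erefl).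

Definition bij_mul f g : self_bij Y :=
  SelfBij (can_comp (bij_funK f) (bij_funK g))
          (can_comp (bij_invK g) (bij_invK f)).

Definition bij_opp f : self_bij Y := SelfBij (bij_invK f) (bij_funK f).

Lemma bij_mulA : associative bij_mul.
Proof. by move=> f g h; exact: self_bijP. Qed.

Lemma bij_mul1 : left_id bij_one bij_mul.
Proof. by move=> f; exact: self_bijP. Qed.

Lemma bij_1mul : right_id bij_one bij_mul.
Proof. by move=> f; exact: self_bijP. Qed.

Lemma bij_mulV : left_inverse bij_one bij_opp bij_mul.
Proof. by move=> f; apply/self_bijP/funext => y; exact: bij_funK. Qed.

Lemma bij_Vmul : right_inverse bij_one bij_opp bij_mul.
Proof. by move=> f; apply/self_bijP/funext => y; exact: bij_invK. Qed.

HB.instance Definition _ := isGroup.Build (self_bij Y)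
  bij_mulA bij_mul1 bij_1mul bij_mulV bij_Vmul.

Lemma bij_fun_mul f g : bij_fun (f * g)%g = bij_fun f \o bij_fun g.
Proof. by []. Qed.
End SelfBijGroup.

(** A group with a family that satisfies no relation: by van der Waerden's trick,
    each letter permutes the set of reduced words. *)
Lemma exists_free_family (I : eqType) : exists (L : groupType) (P : I -> L),
  forall u : word I, reduced u -> word_eval P u = 1%g -> u = [::].
Proof.
pose Om := {u : word I | reduced u}.
pose mv s (u : Om) : Om := Sub (push s (val u)) (push_reduced s (valP u)).
have mvK s : cancel (mv s) (mv (inv_letter s)).
  by move=> u; apply/val_inj; rewrite /= pushK // (valP u).
have mvK' s : cancel (mv (inv_letter s)) (mv s).
  by move=> u; rewrite -{1}(inv_letterK s) mvK.
pose P i : self_bij Om := SelfBij (mvK (i, false)) (mvK' (i, false)).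
exists (self_bij Om), P => u ru u1.
pose o : Om := Sub [::] isT.
have E v : val (bij_fun (word_eval P v) o) = reduce v.
  elim: v => [|[i b] v IH]; first by rewrite word_eval_nil.
  rewrite word_eval_cons bij_fun_mul /= -IH /letter_eval /=.
  by case: b.
by rewrite -(reduce_id ru) -E u1.
Qed.

(** * Deleting one edge of each face *)

Lemma expVgD (G : groupType) (x : G) (i n : nat) :
  (i <= n)%N -> (x ^- n * x ^+ i = x ^- (n - i))%g.
Proof. by move=> le_in; rewrite -{1}(subnKC le_in) expgnDr invgM mulgVK. Qed.

(** Recursion along a rank function: if the value of [F d] at [y] depends only on
    the values of [d] at points of smaller rank, then [F] has a fixed point. *)
Lemma rank_fixpoint (X L : Type) (r : X -> nat) (F : (X -> L) -> X -> L)
    (l0 : L) :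
  (forall d d' y, (forall y', (r y' < r y)%N -> d y' = d' y') ->
     F d y = F d' y) ->
  exists d, forall y, d y = F d y.
Proof.
move=> Floc; pose D n := iter n F (fun=> l0).
have Dstab : forall n y, (r y < n)%N -> D n y = D (r y).+1 y.
  move=> n y; have [k] := ubnP (r y); elim: k n y => // k IH [|n] y //= rk rn.
  apply: Floc => y' ry'; rewrite IH ?(leq_trans ry') //.
  by rewrite [RHS]IH // (leq_trans ry').
exists (fun y => D (r y).+1 y) => y /=; apply: Floc => y' ry'.
exact: Dstab.
Qed.

Lemma reduced_cat (I : eqType) (k : pred I) (u v : word I) :
  all (fun s => k s.1) u -> (if v is s :: _ then ~~ k s.1 else true) ->
  reduced u -> reduced v -> reduced (u ++ v).
Proof.
move=> + kv + rv; elim: u => //= s u IH /andP[ks ku].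
rewrite !reduced_cons => /andP[su ru]; rewrite IH // andbT.
case: u {IH ku ru} su => //=; case: v kv {rv} => // t v kt _.
by apply: contra kt => /eqP ->.
Qed.

Lemma reduced_nseq (I : eqType) (s : I * bool) n : reduced (nseq n s).
Proof.
elim: n => //= n IH; rewrite reduced_cons IH andbT; case: n {IH} => //= n.
by case: s => i []; rewrite /inv_letter xpair_eqE /= andbF.
Qed.

Lemma reduced_map (I J : eqType) (h : I -> J) (u : word I) :
  injective h -> reduced [seq (h s.1, s.2) | s <- u] = reduced u.
Proof.
move=> hI; elim: u => //= s u IH; rewrite !reduced_cons IH.
by case: u {IH} => //= t u; rewrite !xpair_eqE (inj_eq hI).
Qed.

Lemma word_eval_map (I J : Type) (G : groupType) (h : I -> J) (P : J -> G)
    (u : word I) :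
  word_eval P [seq (h s.1, s.2) | s <- u] = word_eval (P \o h) u.
Proof. by rewrite /word_eval big_map. Qed.

(** The standing assumptions are those of the introduction: [Pick false] and
    [Pick true] are the sets of the faces that delete an edge of type
    [e false], resp. [e true], and [r] is the rank. The exponents of the word
    are [p.+1] and [q.+1]. *)
Section Faces.
Variables (G : groupType) (e : bool -> G) (X : Type) (act : G -> X -> X).
Variables (p q : nat) (Pick : bool -> set X) (r : X -> nat).
Hypothesis eF : free_basis e.
Hypothesis actP : is_action act.

Let w : G := (e false ^+ p.+1 * e true ^+ q.+1)%g.
Let len (i : bool) := if i then q else p.

Hypothesis PickI : forall y, Pick false y -> ~ Pick true y.
Hypothesis Pick_rank : forall i y j, Pick false y \/ Pick true y ->
  (0 < j <= len i)%N -> Pick i (act (e i ^- j)%g y) ->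
  (r (act (e i ^- j)%g y) < r y)%N.

Lemma act1x x : act 1%g x = x. Proof. exact: actP.1. Qed.
Lemma actM g h x : act (g * h)%g x = act g (act h x). Proof. exact: actP.2. Qed.
Lemma actK g : cancel (act g) (act g^-1%g).
Proof. by move=> x; rewrite -actM mulVg act1x. Qed.
Lemma actVK g : cancel (act g^-1%g) (act g).
Proof. by move=> x; rewrite -actM mulgV act1x. Qed.

(** The face that deletes the edge of type [i] starting at [x], when there is
    one. *)
Definition picker (i : bool) (x : X) : X :=
  if i then act (e true) x else act (e false ^- p)%g x.

Definition picked (i : bool) (x : X) : Prop := Pick i (picker i x).

(** The edge from [x] along the letter [s] is kept; the inverse letter runs
    through the edge that ends at [x]. *)
Definition kept_letter (s : bool * bool) (x : X) : Prop :=
  ~ picked s.1 (if s.2 then act (e s.1)^-1%g x else x).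

(** The path spelled by [u] from [x], read from right to left, consists of kept
    edges. *)
Fixpoint kept_path (u : word bool) (x : X) : Prop :=
  if u is s :: u' then
    kept_path u' x /\ kept_letter s (act (word_eval e u') x)
  else True.

(** The equivalence relation generated by the kept edges. *)
Definition kept_relation : set (X * X) :=
  [set xy | exists2 u, kept_path u xy.1 & act (word_eval e u) xy.1 = xy.2].

Lemma kept_path_cat u v x : kept_path v x ->
  kept_path u (act (word_eval e v) x) -> kept_path (u ++ v) x.
Proof.
move=> kv; elim: u => //= s u IH [ku ks]; split; first exact: IH.
by rewrite word_eval_cat actM.
Qed.

Lemma kept_path_inv u x : kept_path u x ->
  kept_path (word_inv u) (act (word_eval e u) x).
Proof.
elim: u x => //= s u IH x [ku ks]; rewrite /word_inv /= rev_cons -cats1.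
have E : act (word_eval e [:: inv_letter s]) (act (word_eval e (s :: u)) x) =
         act (word_eval e u) x.
  rewrite -actM !word_eval_cons word_eval_nil mulg1 letter_eval_inv.
  by rewrite mulKg.
apply: kept_path_cat; last by rewrite E; exact: IH.
split=> //=; rewrite word_eval_nil act1x word_eval_cons actM.
case: s ks {E} => i [] /=; rewrite /kept_letter /letter_eval /=.
  by [].
by rewrite actK.
Qed.

Lemma kept_relation_equiv : equiv_relation kept_relation.
Proof.
split=> [x|x y|x y z] /=.
- by exists [::] => //; rewrite word_eval_nil act1x.
- move=> [u /= ku <-]; exists (word_inv u); first exact: kept_path_inv.
  by rewrite word_eval_inv actK.
- move=> [u /= ku <-] [v /= kv <-]; exists (v ++ u); first exact: kept_path_cat.
  by rewrite word_eval_cat actM.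
Qed.

Lemma kept_edge i x : ~ picked i x -> kept_relation (x, act (e i) x).
Proof.
move=> ix; exists [:: (i, false)] => /=.
  by split=> //; rewrite /kept_letter /= word_eval_nil act1x.
by rewrite word_eval_cons word_eval_nil mulg1.
Qed.

Lemma orbit_relation_equiv (H : set G) :
  is_subgroup H -> equiv_relation (orbit_relation act H).
Proof.
move=> [H1 HD]; have HV h : H h -> H h^-1%g by move=> /(HD _ _ H1); rewrite mul1g.
split=> [x|x y|x y z] /=.
- by exists 1%g => //; rewrite act1x.
- by move=> [h Hh /= <-]; exists h^-1%g; [exact: HV | rewrite actK].
- move=> [h Hh /= <-] [k Hk /= <-]; exists (k * h)%g; last by rewrite actM.
  by rewrite -(invgK h); apply: HD => //; exact: HV.
Qed.

Lemma is_subgroup_cyclic (x : G) : is_subgroup (cyclic_subgroup x).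
Proof.
have xN n : cyclic_subgroup x (x ^+ n)%g by exists n%:Z.
have xV n : cyclic_subgroup x (x ^- n)%g.
  by case: n => [|n]; [rewrite expg0 invg1 -(expg0 x) | exists (Negz n)].
split; first exact: (xN 0%N).
have mix i j : cyclic_subgroup x (x ^+ i * x ^- j)%g.
  have [ij|/ltnW ji] := leqP i j.
    by rewrite -{1}(subnK ij) expgnDr invgM mulVKg.
  by rewrite -{1}(subnK ji) expgnDr mulgK.
have cVX i j : (x ^- j * x ^+ i = x ^+ i * x ^- j)%g.
  by apply/esym/commuteV/commuteX2/commute_refl.
move=> _ _ [[i|i] _ <-] [[j|j] _ <-] /=.
- exact: mix.
- by rewrite invgK -expgnDr.
- by rewrite -invgM -expgnDr.
- by rewrite invgK cVX.
Qed.

(** The face of [y] runs from [act (e true ^- q.+1) y] to [y] along edges of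
    type [true], then from [y] to [act (e false ^+ p.+1) y] along edges of type
    [false]; in both parts the last edge is the one [y] may delete. *)
Definition face_start (i : bool) (y : X) : X :=
  if i then act (e true ^- q.+1)%g y else y.

Lemma picker_exp i y j : (j <= len i)%N ->
  picker i (act (e i ^+ j)%g (face_start i y)) = act (e i ^- (len i - j))%g y.
Proof.
case: i => /= jn; rewrite -!actM ?expVgD //.
rewrite -expgS -[in RHS]subSS -expVgD ?ltnS //; congr act.
exact/commuteV/commuteX2/commute_refl.
Qed.

Lemma picked_last i y :
  picked i (act (e i ^+ len i)%g (face_start i y)) = Pick i y.
Proof. by rewrite /picked picker_exp // subnn expg0 invg1 act1x. Qed.

(** The deleted edges of the face of [y], apart from the one that [y] deletes,
    are deleted by faces of smaller rank. *)
Lemma picked_rank i y j : Pick false y \/ Pick true y ->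
  (j < len i)%N \/ (j <= len i)%N /\ ~ Pick i y ->
  picked i (act (e i ^+ j)%g (face_start i y)) ->
  (r (picker i (act (e i ^+ j)%g (face_start i y))) < r y)%N.
Proof.
move=> yP ji; have jn : (j <= len i)%N by case: ji => [/ltnW|[]].
rewrite /picked picker_exp // => Pj; apply: Pick_rank => //.
rewrite leq_subr andbT subn_gt0; case: ji => // -[_ niy].
rewrite ltn_neqAle jn andbT; apply/eqP => jE; apply: niy.
by move: Pj; rewrite jE subnn expg0 invg1 act1x.
Qed.
Lemma face_start_picker i x :
  act (e i ^+ len i)%g (face_start i (picker i x)) = x.
Proof.
case: i => /=; last by rewrite actVK.
by rewrite -!actM expgS invgM mulgA mulgV mul1g mulVg act1x.
Qed.

Lemma face_start_end y : act (e true ^+ q.+1)%g (face_start true y) = y.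
Proof. exact: actVK. Qed.

Lemma act_w y : act w (face_start true y) = act (e false ^+ p.+1)%g y.
Proof. by rewrite actM face_start_end. Qed.

Lemma actS i j x : act (e i ^+ j.+1)%g x = act (e i) (act (e i ^+ j)%g x).
Proof. by rewrite expgS actM. Qed.

Lemma path_related (A : set (X * X)) i n x : equiv_relation A ->
  (forall j, (j < n)%N ->
    A (act (e i ^+ j)%g x, act (e i) (act (e i ^+ j)%g x))) ->
  A (x, act (e i ^+ n)%g x).
Proof.
move=> [Ar As At]; elim: n => [|n IH] An; first by rewrite expg0 act1x.
rewrite actS; apply: At (An _ (ltnSn n)); apply: IH => j jn.
exact/An/ltnW.
Qed.

(** The ends of a deleted edge are joined around its face; the other deleted edges
    of the face are dealt with by induction on the rank. *)
Lemma edge_related (A : set (X * X)) : equiv_relation A ->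
  orbit_relation act (cyclic_subgroup w) `<=` A -> kept_relation `<=` A ->
  forall i x, A (x, act (e i) x).
Proof.
move=> AE wA kA; have [Ar As At] := AE.
have lastA : forall n i y, (r y < n)%N -> Pick i y ->
    let x := act (e i ^+ len i)%g (face_start i y) in A (x, act (e i) x).
  elim=> // n IH i y yn iy /=.
  have yP : Pick false y \/ Pick true y by case: i iy; [right | left].
  have edgeA i' j : (j < len i')%N \/ (j <= len i')%N /\ ~ Pick i' y ->
      let x := act (e i' ^+ j)%g (face_start i' y) in A (x, act (e i') x).
    move=> ji x; have [xP|/kept_edge/kA //] := pselect (picked i' x).
    rewrite -(face_start_picker i' x); apply: IH => //.
    exact: leq_trans (picked_rank yP ji xP) yn.
  have wy : A (face_start true y, act (e false ^+ p.+1)%g y).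
    by apply: wA; exists w; [exists 1%:Z | exact: act_w].
  case: i iy => iy /=.
    apply: (At _ (face_start true y)).
      by apply: As; apply: path_related => // j jq; apply: edgeA; left.
    rewrite -actS face_start_end; apply: At wy _; apply: As.
    apply: path_related => // j jp; apply: (edgeA false); right.
    by split=> // /PickI.
  apply: (At _ y).
    by apply: As; apply: path_related => // j jp; apply: (edgeA false); left.
  rewrite -actS; apply: At wy; apply: As.
  rewrite -[in X in A (_, X)](face_start_end y); apply: path_related => // j jq.
  by apply: edgeA; right; split=> // ty; exact: PickI iy ty.
move=> i x; have [xP|/kept_edge/kA //] := pselect (picked i x).
by rewrite -(face_start_picker i x); exact: lastA xP.
Qed.

Lemma orbit_relation_generated : orbit_relation act [set: G] =
  generated_equiv_relation
    (orbit_relation act (cyclic_subgroup w) `|` kept_relation).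
Proof.
apply/seteqP; split.
  move=> [x y] [g _ /= <-] A [AE]; rewrite subUset => -[wA kA].
  have [Ar As At] := AE; have eA := edge_related AE wA kA.
  rewrite -(word_ofK eF g); elim: (word_of eF g) => [|[i b] u IH].
    by rewrite word_eval_nil act1x.
  rewrite word_eval_cons actM; apply: At IH _; rewrite /letter_eval /=.
  case: b; last exact: eA.
  by apply: As; rewrite -[X in A (_, X)](actVK (e i)); exact: eA.
apply: smallest_sub; first by apply: orbit_relation_equiv.
rewrite subUset; split=> -[x y]; first by move=> [h _ hx]; exists h.
by move=> [u _ ux]; exists (word_eval e u).
Qed.

(** * The cocycle and orthogonality *)
Section Cocycle.
(** In the application [L] is free on the family [P], whose members [P (Some i)]
    and [P None] correspond to the edges of type [e i] and of type [w]. *)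
Variables (L : groupType) (P : option bool -> L).

(** The product of the labels [c i] along [n] edges of type [i] from [x]. *)
Fixpoint label_prod (c : bool -> X -> L) (i : bool) (n : nat) (x : X) : L :=
  if n is m.+1 then (c i (act (e i ^+ m) x) * label_prod c i m x)%g else 1%g.

Lemma eq_label_prod c c' i n x :
  (forall j, (j < n)%N -> c i (act (e i ^+ j)%g x) = c' i (act (e i ^+ j)%g x)) ->
  label_prod c i n x = label_prod c' i n x.
Proof.
elim: n => //= n IH cc'; rewrite cc' // IH // => j jn.
exact/cc'/ltnW.
Qed.

(** A kept edge of type [i] has label [P (Some i)]; the label of a deleted edge
    is the value of [d] at the face that deletes it. *)
Definition label (d : X -> L) (i : bool) (x : X) : L :=
  if `[< picked i x >] then d (picker i x) else P (Some i).

(** The label that the edge deleted by [y] must have so that the labels along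
    the face of [y] multiply to [P None]. *)
Definition solve_face (d : X -> L) (y : X) : L :=
  let part i n := label_prod (label d) i n (face_start i y) in
  if `[< Pick false y >] then
    (P None * (part true q.+1)^-1 * (part false p)^-1)%g
  else if `[< Pick true y >] then
    ((part false p.+1)^-1 * P None * (part true q)^-1)%g
  else 1%g.

Lemma solve_face_local d d' y :
  (forall y', (r y' < r y)%N -> d y' = d' y') ->
  solve_face d y = solve_face d' y.
Proof.
move=> dd'; rewrite /solve_face.
have E i n : Pick false y \/ Pick true y ->
    (forall j, (j < n)%N -> (j < len i)%N \/ (j <= len i)%N /\ ~ Pick i y) ->
    label_prod (label d) i n (face_start i y) =
    label_prod (label d') i n (face_start i y).
  move=> yP nP; apply: eq_label_prod => j jn; rewrite /label.
  case: asboolP => // xP; apply: dd'; apply: picked_rank => //.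
  exact: nP.
case: asboolP => [fy|nfy].
  have yP : Pick false y \/ Pick true y by left.
  rewrite (E true q.+1) ?(E false p) // => j jq; first by left.
  by right; split=> // /(PickI fy).
case: asboolP => [ty|//].
have yP : Pick false y \/ Pick true y by right.
rewrite (E true q) ?(E false p.+1) // => j jq; last by left.
by right.
Qed.

Lemma exists_labelling : exists c : bool -> X -> L,
  [/\ forall i x, ~ picked i x -> c i x = P (Some i) &
      forall y, Pick false y \/ Pick true y ->
        (label_prod c false p.+1 y *
         label_prod c true q.+1 (face_start true y))%g = P None].
Proof.
have [d dE] := rank_fixpoint (1%g : L) solve_face_local.
exists (label d); split=> [i x ix|y yP].
  by rewrite /label; case: asboolP.
have last i : Pick i y -> label d i (act (e i ^+ len i)%g (face_start i y)) = d y.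
  move=> iy; rewrite /label picked_last asboolT // picker_exp // subnn expg0.
  by rewrite invg1 act1x.
have [fy|nfy] := pselect (Pick false y).
  rewrite [label_prod _ false _ _]/= (last false fy) dE /solve_face asboolT //.
  by rewrite mulgVK mulgVK.
have ty : Pick true y by case: yP.
rewrite [label_prod _ true _ _]/= (last true ty) dE /solve_face asboolF //.
by rewrite asboolT // mulgVK mulVKg.
Qed.

Variable c : bool -> X -> L.
Hypothesis c_kept : forall i x, ~ picked i x -> c i x = P (Some i).
Hypothesis c_face : forall y, Pick false y \/ Pick true y ->
  (label_prod c false p.+1 y *
   label_prod c true q.+1 (face_start true y))%g = P None.

Let step i (z : X * L) : X * L := (act (e i) z.1, c i z.1 * z.2)%g.
Let step' i (z : X * L) : X * L :=
  (act (e i)^-1 z.1, (c i (act (e i)^-1 z.1))^-1 * z.2)%g.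

Lemma stepK i : cancel (step i) (step' i).
Proof. by case=> x l; rewrite /step' /= actK mulKg. Qed.

Lemma step'K i : cancel (step' i) (step i).
Proof. by case=> x l; rewrite /step /= actVK mulVKg. Qed.

(** The skew product: the action on [X * L] twisted by the cocycle that extends
    [c]. It exists because [e] is a free basis. *)
Definition skew_act : G -> X * L -> X * L := free_act eF step step'.

Lemma skew_actP : is_action skew_act.
Proof. exact (free_act_is_action eF stepK step'K). Qed.

Lemma skew_act1 z : skew_act 1%g z = z. Proof. exact: skew_actP.1. Qed.
Lemma skew_actM g h z : skew_act (g * h)%g z = skew_act g (skew_act h z).
Proof. exact: skew_actP.2. Qed.

Lemma skew_act_basis i x l :
  skew_act (e i) (x, l) = (act (e i) x, c i x * l)%g.
Proof. by rewrite /skew_act (free_act_basis eF stepK step'K). Qed.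

Lemma skew_act_kept u x l : kept_path u x ->
  skew_act (word_eval e u) (x, l) =
  (act (word_eval e u) x, word_eval (P \o Some) u * l)%g.
Proof.
rewrite /skew_act (free_act_eval eF stepK step'K).
elim: u => [_|[i b] u IH [ku ks]]; first by rewrite !word_eval_nil act1x mul1g.
rewrite /= IH // !word_eval_cons actM -mulgA /letter_act /letter_eval /=.
case: b ks; rewrite /kept_letter /= => ks.
  by rewrite /step' /= c_kept.
by rewrite /step /= c_kept.
Qed.

Lemma skew_act_exp i n x l : skew_act (e i ^+ n)%g (x, l) =
  (act (e i ^+ n) x, label_prod c i n x * l)%g.
Proof.
elim: n => [|n IH]; first by rewrite expg0 skew_act1 act1x mul1g.
by rewrite expgS skew_actM IH skew_act_basis -actM /= mulgA.
Qed.

Lemma skew_act_fst g z : (skew_act g z).1 = act g z.1.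
Proof.
rewrite -(word_ofK eF g) /skew_act (free_act_eval eF stepK step'K).
elim: (word_of eF g) => [|[i b] u IH] /=; first by rewrite word_eval_nil act1x.
by rewrite word_eval_cons actM -IH /letter_act /letter_eval /=; case: b.
Qed.

Section Orthogonal.
Variable B : set X.
Hypothesis BG : forall g x, B x -> B (act g x).
Hypothesis BP : forall x, B x -> Pick false x \/ Pick true x.
Hypothesis B_free : forall g x, B x -> act g x = x -> g = 1%g.
Hypothesis P_free :
  forall u : word (option bool), reduced u -> word_eval P u = 1%g -> u = [::].

Lemma skew_act_w x l : B x -> skew_act w (x, l) = (act w x, P None * l)%g.
Proof.
move=> Bx; rewrite skew_actM skew_act_exp skew_act_exp actM.
rewrite mulgA -[in RHS](c_face (BP (BG (e true ^+ q.+1)%g Bx))).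
by rewrite /= actK.
Qed.

Lemma skew_act_wX n x l : B x ->
  skew_act (w ^+ n)%g (x, l) = (act (w ^+ n) x, P None ^+ n * l)%g.
Proof.
move=> Bx; elim: n => [|n IH]; first by rewrite !expg0 skew_act1 act1x mul1g.
rewrite expgS skew_actM IH skew_act_w; last exact: BG.
by rewrite -actM [in RHS]expgS mulgA.
Qed.

Lemma skew_act_wZ m x l : B x ->
  skew_act (expgz w m) (x, l) = (act (expgz w m) x, expgz (P None) m * l)%g.
Proof.
move=> Bx; case: m => n /=; first exact: skew_act_wX.
rewrite -[RHS]skew_act1 -(mulVg (w ^+ n.+1)%g) skew_actM skew_act_wX.
  by rewrite actVK mulgA mulgV mul1g.
exact: BG.
Qed.

Lemma expgz_word (K : groupType) (h : option bool -> K) m :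
  expgz (h None) m =
  word_eval h (nseq `|m|%N (None, if m is Negz _ then true else false)).
Proof.
have E b n : word_eval h (nseq n (None, b)) =
    if b then (h None ^- n)%g else (h None ^+ n)%g.
  elim: n => [|n IH]; first by rewrite word_eval_nil expg0 invg1; case: b.
  rewrite /= word_eval_cons IH /letter_eval /=; case: b {IH}; last by rewrite expgS.
  by rewrite expgSr invgM.
by case: m => n; rewrite E.
Qed.

(** Following the point [(x_0, 1)] of the skew product around an alternating cycle
    multiplies its second coordinate by a reduced word; around the whole cycle
    the acting group element is trivial by freeness. *)
Lemma kept_orthogonal : orthogonal_relations
  (restrict_relation (orbit_relation act (cyclic_subgroup w)) B)
  (restrict_relation kept_relation B).
Proof.
move=> n x n0 x1 x2; apply: contrapT => /forallNP xN.
have n20 : (0 < n.*2)%N by rewrite double_gt0.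
pose s j := iter j (@ordS _) (Ordinal n20).
have sE j : s j = (j %% n.*2)%N :> nat.
  elim: j => [|j IH]; first by rewrite mod0n.
  by rewrite /= IH -addn1 modnDml addn1.
have odd_s j : odd (s j) = odd j by rewrite sE odd_mod // odd_double.
have walk j : exists (g : G) (V : word (option bool)),
    [/\ skew_act g (x (s 0%N), 1%g) = (x (s j), word_eval P V), reduced V &
        if V is t :: _ then (t.1 == None) = ~~ odd j else j = 0%N].
  elim: j => [|j [g [V [gV rV Vj]]]].
    by exists 1%g, [::]; rewrite skew_act1 word_eval_nil.
  have xj : x (s j) <> x (s j.+1) by exact: xN.
  have [oj|ej] := boolP (odd j).
    have := x1 (s j); rewrite odd_s => /(_ oj)[[h [m _ hm] /= hx] [Bx _]].
    rewrite -/(s j.+1) in hx.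
    pose T : word (option bool) :=
      nseq `|m|%N (None, if m is Negz _ then true else false).
    have m0 : m != 0.
      by apply/eqP => m0; apply: xj; rewrite -hx -hm m0 /= expg0 act1x.
    exists (h * g)%g, (T ++ V); split.
    - by rewrite skew_actM gV -hm skew_act_wZ // hm hx word_eval_cat expgz_word.
    - apply: (reduced_cat (k := pred1 None)) => //; last exact: reduced_nseq.
        by apply/allP => t /nseqP[-> _] /=.
      by case: V Vj {gV rV} => // t V /= ->; rewrite oj.
    - by move: m0; rewrite /T /= oj -absz_eq0; case: `|m|%N.
  (* The path of kept edges need not be reduced, but its reduced form has the
     same value, and it is nonempty because the path is not closed. *)
  have := x2 (s j); rewrite odd_s => /(_ ej)[[u /= ku ux] [Bx _]].
  rewrite -/(s j.+1) in ux.
  pose T : word (option bool) := [seq (Some t.1, t.2) | t <- reduce u].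
  have T0 : T != [::].
    apply/eqP => /(congr1 size); rewrite size_map => /size0nil u1; apply: xj.
    by rewrite -ux -word_eval_reduce u1 word_eval_nil act1x.
  exists (word_eval e u * g)%g, (T ++ V); split.
  - rewrite skew_actM gV skew_act_kept // ux word_eval_cat.
    by rewrite word_eval_map word_eval_reduce.
  - apply: (reduced_cat (k := predC (pred1 None))) => //.
    + by apply/allP => _ /mapP[t _ ->].
    + by case: V Vj {gV rV} => // t V /= ->; rewrite ej.
    + by rewrite reduced_map ?reduce_reduced // => ? ? [].
  - move: T0; rewrite /T /= ej; case: (reduce u) => // t U _ /=.
have [g [V [gV rV]]] := walk n.*2.
have s0 : s n.*2 = s 0%N by apply/ord_inj; rewrite !sE modnn mod0n.
rewrite s0 in gV.
have Bx0 : B (x (s 0%N)) by have /x2[_ []] : ~~ odd (s 0%N) by [].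
have g1 : g = 1%g.
  by apply: B_free Bx0 _; have := skew_act_fst g (x (s 0%N), 1%g); rewrite gV.
move: gV; rewrite g1 skew_act1 => -[/esym /(P_free rV) ->] /eqP.
by rewrite double_eq0 -leqn0 leqNgt n0.
Qed.
End Orthogonal.
End Cocycle.
End Faces.

(** Orthogonality on an invariant set [B] of free orbits on which every point picks
    an edge; [L] is now a free group on three letters. *)
Theorem kept_relation_orthogonal (G : groupType) (e : bool -> G) (X : Type)
    (act : G -> X -> X) (p q : nat) (Pick : bool -> set X) (r : X -> nat)
    (B : set X) :
  free_basis e -> is_action act ->
  (forall y, Pick false y -> ~ Pick true y) ->
  (forall i y j, Pick false y \/ Pick true y ->
    (0 < j <= if i then q else p)%N -> Pick i (act (e i ^- j)%g y) ->
    (r (act (e i ^- j)%g y) < r y)%N) ->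
  (forall g x, B x -> B (act g x)) ->
  (forall x, B x -> Pick false x \/ Pick true x) ->
  (forall g x, B x -> act g x = x -> g = 1%g) ->
  orthogonal_relations
    (restrict_relation (orbit_relation act
      (cyclic_subgroup (e false ^+ p.+1 * e true ^+ q.+1)%g)) B)
    (restrict_relation (kept_relation e act p Pick) B).
Proof.
move=> eF actP PI Pr BG BP Bf.
have [L [P Pf]] := exists_free_family (option bool).
have [c [ck cf]] := exists_labelling actP PI Pr P.
exact: (kept_orthogonal eF actP ck cf).
Qed.

(** * The uniform measure on sequences of digits *)

Section Digits.
Variables (R : realType) (m : nat).
Let M := m.+2.

(** The digit in position [i] of the expansion of [x] in base [M], where position
    [0] is the first one after the radix point. *)
Definition digit (i : nat) (x : R) : 'I_M :=
  inord (Num.truncn (x * M%:R ^+ i.+1) %% M).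

Lemma truncn_divn (N i : nat) (x : R) : (i <= N)%N -> 0 <= x ->
  Num.truncn (x * M%:R ^+ i) = (Num.truncn (x * M%:R ^+ N) %/ M ^ (N - i))%N.
Proof.
move=> iN x0; set k := Num.truncn (x * M%:R ^+ N).
have P0 : (0 < M ^ (N - i))%N by rewrite expn_gt0.
have PR0 : 0 < (M ^ (N - i))%:R :> R by rewrite ltr0n.
have := truncn_itv (mulr_ge0 x0 (exprn_ge0 N (ler0n R M))); rewrite -/k.
have -> : M%:R ^+ N = M%:R ^+ i * (M ^ (N - i))%:R :> R.
  by rewrite natrX -exprD subnKC.
rewrite mulrA => /andP[kx xk]; apply: truncn_def; apply/andP; split.
  rewrite -(ler_pM2r PR0) (le_trans _ kx) // -natrM ler_nat.
  exact: leq_trunc_div.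
rewrite -(ltr_pM2r PR0) (lt_le_trans xk) // -natrM ler_nat.
exact: ltn_ceil.
Qed.

Lemma measurable_truncn (Q : pred nat) (c : R) : 0 < c ->
  measurable [set x : R | Q (Num.truncn (x * c))].
Proof.
move=> c0; have le_meas n : measurable [set x : R | (Num.truncn (x * c) <= n)%N].
  suff -> : [set x : R | (Num.truncn (x * c) <= n)%N] = `]-oo, n.+1%:R / c[%classic.
    exact: measurable_itv.
  apply/seteqP; split=> x /=; rewrite in_itv /= ltr_pdivlMr // truncn_le_nat //.
have -> : [set x : R | Q (Num.truncn (x * c))] =
    \bigcup_(n in [set n | Q n]) ([set x : R | (Num.truncn (x * c) <= n)%N] `\`
      \bigcup_(k in `I_n) [set x : R | (Num.truncn (x * c) <= k)%N]).
  apply/seteqP; split=> [x /= Qx|x [n /= Qn [xn xk]]].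
    by exists (Num.truncn (x * c)) => //; split=> //= -[k /= kx]; rewrite leqNgt kx.
  have [lt|gt|->//] := ltngtP (Num.truncn (x * c)) n; last by rewrite leqNgt gt in xn.
  by case: xk; exists (Num.truncn (x * c)) => /=.
apply: bigcup_measurable => n _; apply: measurableD => //.
by apply: bigcup_measurable => k _.
Qed.

(** Each interval between consecutive multiples of [M ^- N] has measure
    [M ^- N]. *)
Lemma lebesgue_truncn (Q : pred nat) (N : nat) :
  lebesgue_measure ([set x : R | Q (Num.truncn (x * M%:R ^+ N))] `&` `[0, 1[) =
  (#|[pred k : 'I_(M ^ N) | Q k]|%:R / M%:R ^+ N)%:E.
Proof.
have P0 : 0 < M%:R ^+ N :> R by rewrite exprn_gt0 // ltr0n.
pose F k : set R :=
  if Q k then `[k%:R / M%:R ^+ N, k.+1%:R / M%:R ^+ N[%classic else set0.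
have FE k x : F k x -> 0 <= x /\ Num.truncn (x * M%:R ^+ N) = k.
  rewrite /F; case: ifP => // _; rewrite /= in_itv /= => /andP[kx xk].
  split; first by rewrite (le_trans _ kx) // divr_ge0 // ltW.
  by apply: truncn_def; rewrite -ler_pdivrMr // kx -ltr_pdivlMr.
have -> : [set x : R | Q (Num.truncn (x * M%:R ^+ N))] `&` `[0, 1[ =
    \big[setU/set0]_(k < M ^ N) F k.
  rewrite -bigcup_mkord; apply/seteqP; split=> [x [/= Qx]|x [k /= kN Fk]].
    rewrite in_itv /= => /andP[x0 x1].
    have xM0 : 0 <= x * M%:R ^+ N by rewrite mulr_ge0 // ltW.
    exists (Num.truncn (x * M%:R ^+ N)) => /=.
      by rewrite truncn_lt_nat // natrX -[ltRHS]mul1r ltr_pM2r.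
    rewrite /F Qx /= in_itv /= ler_pdivrMr // ltr_pdivlMr //.
    exact: truncn_itv.
  have [x0 xk] := FE _ _ Fk; split; rewrite /= ?xk.
    by move: Fk; rewrite /F; case: ifP.
  move: Fk; rewrite /F; case: ifP => // _; rewrite /= !in_itv /= => /andP[_ xk'].
  rewrite x0 (lt_le_trans xk') // ler_pdivrMr // mul1r -natrX ler_nat.
  exact: kN.
rewrite measure_bigsetU //; last 2 first.
- by move=> k; rewrite /F; case: ifP => // _; exact: measurable_itv.
- apply/trivIsetP => i j _ _ ij; apply/seteqP; split=> // x [] /FE[_ xi] /FE[_ xj].
  by case/eqP: ij; rewrite -xi -xj.
have FM k : lebesgue_measure (F k) = ((Q k)%:R / M%:R ^+ N : R)%:E.
  rewrite /F; case: ifP => _; last by rewrite measure0 mul0r.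
  rewrite lebesgue_measure_itv /= lte_fin ltr_pM2r ?invr_gt0 // ltr_nat ltnSn.
  by rewrite -EFinB -mulrBl -natr1 [_ + 1]addrC addrK.
transitivity (\sum_(k < M ^ N) ((Q k)%:R / M%:R ^+ N : R)%:E)%E.
  by apply: eq_bigr => k _; exact: FM.
rewrite sumEFin -mulr_suml -natr_sum; congr ((_%:R / _)%:E).
rewrite -sum1_card [in RHS]big_mkcond /=; apply: eq_bigr => k _.
by rewrite inE; case: (Q k).
Qed.

Lemma base_inj N (k l : nat) : (k < M ^ N)%N -> (l < M ^ N)%N ->
  (forall i, (i < N)%N -> (k %/ M ^ i = l %/ M ^ i %[mod M])%N) -> k = l.
Proof.
elim: N k l => [|N IH] k l; first by rewrite expn0 !ltnS !leqn0 => /eqP-> /eqP->.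
rewrite expnSr => kN lN kl.
rewrite (divn_eq k M) (divn_eq l M); have := kl 0%N isT; rewrite expn0 !divn1 => ->.
congr (_ * _ + _)%N; apply: IH; rewrite ?ltn_divLR // => i iN.
by have := kl i.+1 iN; rewrite expnS !divnMA.
Qed.

(** Prescribing the digits of pairwise distinct positions divides the number of
    integers below [M ^ N] by [M] for each of them. *)
Lemma card_digits N (s : seq nat) (v : nat -> 'I_M) :
  uniq s -> {in s, forall i, (i < N)%N} ->
  #|[pred k : 'I_(M ^ N) |
     all (fun i => (k %/ M ^ (N - i.+1) %% M)%N == v i) s]| = (M ^ (N - size s))%N.
Proof.
move=> us sN.
pose f (k : 'I_(M ^ N)) : {ffun 'I_N -> 'I_M} :=
  [ffun i : 'I_N => inord (k %/ M ^ (N - i.+1) %% M)].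
have fE k i : f k i = (k %/ M ^ (N - i.+1) %% M)%N :> nat.
  by rewrite ffunE inordK // ltn_mod.
have f_inj : injective f.
  move=> k l kl; apply/ord_inj; apply: (base_inj (N := N)) => // i iN.
  have iN' : (N - i.+1 < N)%N by rewrite ltn_subrL (leq_trans _ iN).
  have := congr1 (fun g : {ffun 'I_N -> 'I_M} => val (g (Ordinal iN'))) kl.
  by rewrite /= !fE /= subnSK // subKn // ltnW.
have card_f : (#|{ffun 'I_N -> 'I_M}| <= #|'I_(M ^ N)|)%N.
  by rewrite card_ffun !card_ord.
have f_bij := inj_card_bij f_inj card_f.
have f_surj y : exists k, f k = y by case: f_bij => g _ gK; exists (g y).
pose F (i : 'I_N) : pred 'I_M := fun d => (val i \in s) ==> (d == v i).
rewrite -cardsE -(card_imset _ f_inj).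
have -> : (f @: [set k : 'I_(M ^ N) |
    all (fun i => (k %/ M ^ (N - i.+1) %% M)%N == v i) s])%SET =
    [set g in family F]%SET.
  apply/setP => g; have [k <-] := f_surj g; rewrite mem_imset // !inE.
  apply/allP/familyP => [sk i|kF i si].
    by apply/implyP => /sk /eqP iE; apply/eqP/ord_inj; rewrite fE.
  have /implyP := kF (Ordinal (sN _ si)).
  by move=> /(_ si) /eqP /(congr1 val) /=; rewrite fE => ->.
rewrite cardsE card_family foldrE big_map big_enum /=.
rewrite (eq_bigr (fun i : 'I_N => if val i \in s then 1%N else M)); last first.
  move=> i _; case: ifP => si.
    by rewrite -(card1 (v i)); apply: eq_card => d; rewrite !inE /F si.
  rewrite -[RHS]card_ord; apply: eq_card => d; rewrite !inE /F.
  by rewrite [_ \in F i]unfold_in /F si.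
rewrite (bigID (fun i : 'I_N => val i \in s)) /= big1 ?mul1n; last first.
  by move=> i ->.
rewrite (eq_bigr (fun=> M)); last by move=> i /negPf ->.
rewrite prod_nat_const; congr (_ ^ _)%N.
rewrite -[in RHS](card_ord N) -(cardC [pred i : 'I_N | val i \in s]).
suff -> : #|[pred i : 'I_N | val i \in s]| = size s by rewrite addKn.
rewrite cardE -(size_map val); apply/perm_size/uniq_perm => //.
  by rewrite map_inj_uniq ?enum_uniq //; exact: val_inj.
move=> i; apply/mapP/idP => [[j + ->]|si]; first by rewrite mem_enum inE.
by exists (Ordinal (sN _ si)); rewrite // mem_enum inE.
Qed.

Lemma lebesgue_digits (s : seq nat) (v : nat -> 'I_M) : uniq s ->
  lebesgue_measure ([set x : R | {in s, forall i, digit i x = v i}] `&` `[0, 1[) =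
  (M%:R ^- size s)%:E.
Proof.
move=> us; pose N := (\max_(i <- s) i).+1.
have sN : {in s, forall i, (i < N)%N} by move=> i si; rewrite ltnS leq_bigmax_seq.
pose Q k := all (fun i => (k %/ M ^ (N - i.+1) %% M)%N == v i) s.
have -> : [set x : R | {in s, forall i, digit i x = v i}] `&` `[0, 1[ =
    [set x : R | Q (Num.truncn (x * M%:R ^+ N))] `&` `[0, 1[.
  apply/seteqP; split=> x [/= xs x01]; split=> //=; have x0 : 0 <= x.
  - by move: x01; rewrite in_itv /= => /andP[].
  - apply/allP => i si; rewrite -truncn_divn ?sN // -(xs _ si) /digit inordK //.
    by rewrite ltn_mod.
  - by move: x01; rewrite in_itv /= => /andP[].
  - move=> i si; apply/ord_inj; rewrite /digit inordK ?ltn_mod //.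
    by rewrite (truncn_divn (sN _ si) x0); apply/eqP/(allP xs).
rewrite lebesgue_truncn card_digits // natrX; congr EFin.
have sizeN : (size s <= N)%N.
  rewrite -(size_iota 0 N); apply: uniq_leq_size => // i si.
  by rewrite mem_iota /= add0n sN.
have M0 : M%:R != 0 :> R by rewrite pnatr_eq0.
by rewrite -{2}(subnK sizeN) exprD invfM mulrA divff ?mul1r // expf_neq0.
Qed.

Lemma measurable_digit (i : nat) (d : 'I_M) :
  measurable [set x : R | digit i x = d].
Proof.
rewrite (_ : [set x : R | digit i x = d] =
  [set x : R | inord (Num.truncn (x * M%:R ^+ i.+1) %% M) == d]).
  apply: (measurable_truncn (fun k => inord (k %% M) == d)).
  by rewrite exprn_gt0 // ltr0n.
by apply/seteqP; split=> x /eqP.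
Qed.
End Digits.

(** * The space of families of digits *)

(** Families of digits in base [m.+2] indexed by [T]. The phantom parameters [R]
    and [code] determine the pseudometric: [R] is the type of the radii, and
    [code], assumed injective below, enumerates the indices. *)
Definition config (R : realType) (m : nat) (T : choiceType) (code : T -> nat)
  : Type := T -> 'I_m.+2.

Section ConfigTopology.
Variables (R : realType) (m : nat) (T : choiceType) (code : T -> nat).
Local Notation X := (config R m code).
Implicit Types (x y : X) (s : seq T).

HB.instance Definition _ := gen_eqMixin X.
HB.instance Definition _ := gen_choiceMixin X.
HB.instance Definition _ := isPointed.Build X (fun=> ord0).

(** The points at distance less than [e] from [x] are those that agree with [x] at
    the indices of code less than [e^-1]. *)
Definition config_ball (x : X) (e : R) (y : X) : Prop :=
  0 < e /\ forall t, (code t)%:R * e < 1 -> x t = y t.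

Let ent : set_system (X * X) := entourage_ config_ball.
Let config_nbhs (x : X) : set_system X := nbhs_ ent x.
Let config_nbhsE : config_nbhs = nbhs_ ent. Proof. by []. Qed.

HB.instance Definition _ := hasNbhs.Build X config_nbhs.

Let ball_center x (e : R) : 0 < e -> config_ball x e x.
Proof. by []. Qed.

Let ball_sym x y (e : R) : config_ball x e y -> config_ball y e x.
Proof. by move=> [e0 xy]; split=> // t /xy. Qed.

Let ball_triangle x y z e1 e2 : config_ball x e1 y -> config_ball y e2 z ->
  config_ball x (e1 + e2) z.
Proof.
move=> [e10 xy] [e20 yz]; split=> [|t te]; first exact: addr_gt0.
rewrite xy ?yz // (le_lt_trans _ te) // ler_wpM2l // ?lerDl ?lerDr; exact: ltW.
Qed.

HB.instance Definition _ := @Nbhs_isPseudoMetric.Build R X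
  ent config_nbhsE config_ball ball_center ball_sym ball_triangle erefl.

Lemma config_complete (F : set_system X) : ProperFilter F -> cauchy F -> cvg F.
Proof.
move=> FF /cauchy_ballP cF.
have Fe (e : R) : 0 < e -> exists x Q, F Q /\ Q `<=` config_ball x e.
  move=> /cF[[/= P Q] [FP FQ] PQ]; have [x Px] := @filter_ex _ F _ _ FP.
  by exists x, Q; split=> // y Qy; exact: (PQ (x, y)).
have Ft t : exists d, F [set x | x t = d].
  have [|x [Q [FQ xQ]]] := Fe (code t).+1%:R^-1; first by rewrite invr_gt0 ltr0n.
  exists (x t); apply: filterS FQ => y /xQ[_ /(_ t) yt]; apply/esym/yt.
  by rewrite ltr_pdivrMr ?ltr0n // mul1r ltr_nat.
pose x : X := fun t => projT1 (cid (Ft t)).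
have Fx t : F [set y | y t = x t] by exact: (projT2 (cid (Ft t))).
apply/cvg_ex; exists x => U /nbhs_ballP[e /= e0 eU]; apply: filterS eU _.
have [z [Q [FQ zQ]]] := Fe e e0; apply: (filterS _ FQ) => y Qy; split=> // t te.
have [y' [/= <- Qy']] := @filter_ex _ F _ _ (filterI (Fx t) FQ).
by rewrite -(zQ _ Qy').2 // -(zQ _ Qy).2.
Qed.

HB.instance Definition _ := Uniform_isComplete.Build X config_complete.

(** The cylinder of the points that agree with [x] on [s]. *)
Definition cyl (s : seq T) (x : X) : set X :=
  [set y | {in s, forall t, y t = x t}].

Hypothesis code_inj : injective code.

(** The index of code [i], as a sequence of length at most one. *)
Definition decode_index (i : nat) : seq T :=
  if pselect (exists t, code t = i) is left P then [:: projT1 (cid P)] else [::].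

Lemma decode_indexE i : decode_index i = [::] \/ exists2 t, code t = i & decode_index i = [:: t].
Proof.
rewrite /decode_index; case: pselect => [P|_]; last by left.
by right; exists (projT1 (cid P)) => //; case: cid.
Qed.

Lemma decode_indexK t : decode_index (code t) = [:: t].
Proof.
rewrite /decode_index; case: pselect => [P|[]]; last by exists t.
by case: cid => u /= /code_inj ->.
Qed.

(** The indices of code less than [n]. *)
Definition window (n : nat) : seq T := flatten [seq decode_index i | i <- iota 0 n].

Lemma mem_window n t : (t \in window n) = (code t < n)%N.
Proof.
apply/flatten_mapP/idP => [[i]|tn].
  rewrite mem_iota /= add0n => lin.
  by case: (decode_indexE i) => [->//|[u ui ->]]; rewrite inE => /eqP ->; rewrite ui.
by exists (code t); rewrite ?mem_iota // decode_indexK mem_head.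
Qed.

Lemma nbhs_cylP x (U : set X) : nbhs x U <-> exists s, cyl s x `<=` U.
Proof.
split.
  move=> /nbhs_ballP[e /= e0 eU].
  exists (window (Num.truncn e^-1).+1) => y xy; apply: eU; split=> // t te.
  apply/esym/xy; rewrite mem_window ltnS.
  have e'0 : 0 <= e^-1 by rewrite invr_ge0 ltW.
  rewrite truncn_ge_nat // ltW //.
  by rewrite -[ltRHS]mul1r ltr_pdivlMr.
move=> [s sU]; pose n := (\max_(t <- s) code t).+1.
have n0 : 0 < n%:R^-1 :> R by rewrite invr_gt0 ltr0n.
apply/nbhs_ballP; exists n%:R^-1 => //= y [_ xy]; apply: sU => t st.
apply/esym/xy; rewrite ltr_pdivrMr ?ltr0n // mul1r ltr_nat ltnS.
exact: leq_bigmax_seq.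
Qed.

Lemma open_cyl s x : open (cyl s x).
Proof.
rewrite openE => y yx; apply/nbhs_cylP; exists s => z zy t st.
by rewrite zy // yx.
Qed.

Lemma config_hausdorff : hausdorff_space X.
Proof.
move=> x y xy; apply/funext => t.
have nx z : nbhs z (cyl [:: t] z) by apply/nbhs_cylP; exists [:: t].
have [z [zx zy]] := xy _ _ (nx x) (nx y).
by rewrite -zx ?mem_head // zy ?mem_head.
Qed.

Lemma countable_cyl (I : countType) (s : I -> seq T) :
  countable [set U | exists i x, U = cyl (s i) x].
Proof.
pose f (k : I * seq 'I_m.+2) : set X :=
  [set y | all (fun t => y t == nth ord0 k.2 (index t (s k.1))) (s k.1)].
apply: (@sub_countable _ _ _ (range f)); last first.
  exact: sub_countable (card_image_le _ _) (countableP _).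
apply: subset_card_le => _ [i [x ->]]; exists (i, [seq x t | t <- s i]) => //.
apply/seteqP; split=> y /= yx.
  move=> t st; move: yx => /allP /(_ _ st) /eqP.
  by rewrite (nth_map t) ?index_mem // nth_index.
apply/allP => t st; apply/eqP; rewrite (nth_map t) ?index_mem // nth_index //.
exact: yx.
Qed.

Lemma config_second_countable : @second_countable X.
Proof.
exists [set U | exists n x, U = cyl (window n) x]; first exact: countable_cyl.
split=> [_ [n [x ->]]|x U /nbhs_cylP[s sU]]; first exact: open_cyl.
pose n := (\max_(t <- s) code t).+1.
exists (cyl (window n) x); first by split=> //; exists n, x.
move=> y yx; apply: sU => t st; apply: yx; rewrite mem_window ltnS.
exact: leq_bigmax_seq.
Qed.

End ConfigTopology.

Section ConfigMeasure.
Variables (R : realType) (m : nat) (T : choiceType) (code : T -> nat).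
Hypothesis code_inj : injective code.
Local Notation X := (config R m code).

(** The families of digits with their Borel sigma-algebra. *)
Definition config_borel := g_sigma_algebraType (@open X).
Local Notation Y := config_borel.

Lemma config_standard_borel : standard_borel R Y.
Proof.
exists X, id; split.
- exact: config_hausdorff.
- exact: config_second_countable.
- exact (inv_bij (fun=> erefl)).
- by apply/seteqP; split=> [A mA|_ [A mA <-]]; [exists A | exact: mA].
Qed.

Lemma measurable_cyl s (x : X) : measurable (cyl s x : set Y).
Proof. by apply: sub_sigma_algebra; exact: open_cyl. Qed.

Lemma eq_cyl s (x y : X) : {in s, x =1 y} -> cyl s x = cyl s y.
Proof.
by move=> xy; apply/seteqP; split=> z zx t st; rewrite zx // xy.
Qed.

(** The point whose values on [s] are listed by [l]. *)
Definition config_of_seq (s : seq T) (l : seq 'I_m.+2) : X :=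
  fun t => nth ord0 l (index t s).

Lemma cyl_of_seq s (x : X) : cyl s x = cyl s (config_of_seq s [seq x t | t <- s]).
Proof.
apply: eq_cyl => t st.
by rewrite /config_of_seq (nth_map t) ?index_mem // nth_index.
Qed.

(** The cylinders over an exhausting family of finite sets of indices generate the
    Borel sets, since there are countably many of them. *)
Lemma generated_cyl (s : nat -> seq T) (G : set (set X)) :
  (forall F : seq T, exists N, {subset F <= s N}) ->
  (forall N x, G (cyl (s N) x)) -> G `<=` @measurable _ Y ->
  @measurable _ Y = <<s G >>.
Proof.
move=> sF sG Gm; apply/seteqP; split; last first.
  by apply: smallest_sub => //; exact: sigma_algebra_measurable.
apply: smallest_sub; first exact: smallest_sigma_algebra.
move=> U; rewrite openE => oU.
pose C (k : nat * seq 'I_m.+2) := cyl (s k.1) (config_of_seq (s k.1) k.2).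
have -> : U = \bigcup_k (if `[< C k `<=` U >] then C k else set0).
  apply/seteqP; split=> [x /oU /(nbhs_cylP code_inj)[F FU]|x [k _]]; last first.
    by case: asboolP => // kU /kU.
  have [N FN] := sF F; exists (N, [seq x t | t <- s N]) => //=.
  have CE : C (N, [seq x t | t <- s N]) = cyl (s N) x by rewrite [RHS]cyl_of_seq.
  rewrite CE asboolT; first by [].
  by move=> y yx; apply: FU => t /FN; exact: yx.
apply: (@countable_bigcupT_measurable _ (g_sigma_algebraType G)) => //.
move=> k; case: asboolP => _; last exact: measurable0.
by apply: sub_sigma_algebra; exact: sG.
Qed.

Lemma window_exhausts (F : seq T) : exists n, {subset F <= window code n}.
Proof.
exists (\max_(t <- F) code t).+1 => t tF.
by rewrite mem_window // ltnS leq_bigmax_seq.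
Qed.

Lemma measurable_coord (t : T) (Q : pred 'I_m.+2) :
  measurable [set x : Y | Q (x t)].
Proof.
rewrite (_ : [set x : Y | Q (x t)] =
  \bigcup_(d in [set d | Q d]) cyl [:: t] (fun=> d : 'I_m.+2)).
  by apply: fin_bigcup_measurable => [|d _]; [exact: finite_finset | exact: measurable_cyl].
apply/seteqP; split=> x /= => [Qx|[d /= Qd xd]].
  by exists (x t) => // u; rewrite inE => /eqP ->.
by rewrite xd ?mem_head.
Qed.

Lemma measurable_config d (aT : measurableType d) (f : aT -> Y) :
  (forall t c, measurable [set z | f z t = c]) -> measurable_fun [set: aT] f.
Proof.
move=> fm.
pose G : set (set Y) := [set U | exists n x, U = cyl (window code n) x].
have GE : @measurable _ Y = <<s G >>.
  apply: (generated_cyl window_exhausts); first by move=> n x; exists n, x.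
  by move=> _ [n [x ->]]; exact: measurable_cyl.
apply: (measurability G GE).
move=> _ [_ [n [x ->]] <-]; rewrite setTI.
have -> : f @^-1` cyl (window code n) x =
    \bigcap_(t in [set` window code n]) [set z | f z t = x t].
  by apply/seteqP; split=> z zx t; [move=> /zx | move=> st; apply: zx].
by apply: fin_bigcap_measurable => // t _; exact: fm.
Qed.

Lemma measurable_eq d (aT : measurableType d) (f g : aT -> Y) :
  measurable_fun [set: aT] f -> measurable_fun [set: aT] g ->
  measurable [set z | f z = g z].
Proof.
move=> fm gm.
have -> : [set z | f z = g z] = \bigcap_n \bigcap_(t in [set` window code n])
    \bigcup_(c in [set: 'I_m.+2]) ([set z | f z t = c] `&` [set z | g z t = c]).
  apply/seteqP; split=> z /=.
    by move=> fg n _ t _; exists (f z t) => //; split; rewrite /= ?fg.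
  move=> fg; apply/funext => t.
  have [n tn] := window_exhausts [:: t].
  by have [c _ [/= -> ->]] := fg n I t (tn t (mem_head _ _)).
have cm h t c : measurable_fun [set: aT] h -> measurable [set z | (h z : Y) t = c].
  move=> hm; have := hm measurableT _ (measurable_coord t (pred1 c)).
  by rewrite setTI; congr measurable; apply/seteqP; split=> z /eqP.
apply: bigcapT_measurable => n; apply: fin_bigcap_measurable => // t _.
apply: fin_bigcup_measurable => [|c _]; first exact: finite_finset.
by apply: measurableI; exact: cm.
Qed.

(** The family of digits of a real number, arranged according to [code]. *)
Definition digits (x : measurableTypeR R) : Y := fun t => digit m (code t) x.

Lemma measurable_digits : measurable_fun [set: measurableTypeR R] digits.
Proof. by apply: measurable_config => t c; exact: measurable_digit. Qed.

(** Lebesgue measure restricted to the half-open unit interval. *)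
Definition unit_lebesgue : set (measurableTypeR R) -> \bar R :=
  mrestr (@lebesgue_measure R) (measurable_itv `[0%R, 1%R[).

HB.instance Definition _ := Measure.copy unit_lebesgue
  (mrestr (@lebesgue_measure R) (measurable_itv `[0%R, 1%R[)).

Let unit_lebesgue_setT : unit_lebesgue setT = 1%E.
Proof.
rewrite /unit_lebesgue /mrestr setTI lebesgue_measure_itv /= lte_fin ltr01.
by rewrite oppr0 adde0.
Qed.

HB.instance Definition _ :=
  Measure_isProbability.Build _ _ R unit_lebesgue unit_lebesgue_setT.

Lemma exists_uniform_measure : exists mu : probability Y R,
  forall (s : seq T) (x : X), uniq s -> mu (cyl s x) = (m.+2%:R ^- size s)%:E.
Proof.
pose dm := isMeasurableFun.Build _ _ _ _ digits measurable_digits.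
pose dg : {mfun measurableTypeR R >-> Y} := HB.pack digits dm.
exists (distribution unit_lebesgue dg) => s x us.
pose v i : 'I_m.+2 := if decode_index code i is t :: _ then x t else ord0.
rewrite /distribution /pushforward /= /unit_lebesgue /mrestr.
rewrite -(size_map code) -(lebesgue_digits R v) ?map_inj_uniq //.
congr (lebesgue_measure (_ `&` _)); apply/seteqP; split=> z /= zs.
  move=> _ /mapP[t ts ->]; rewrite /v decode_indexK //; exact: zs.
by move=> t ts; have := zs (code t) (map_f _ ts); rewrite /v decode_indexK.
Qed.

Section Preserves.
Variable mu : probability Y R.
Hypothesis mu_cyl : forall (s : seq T) (x : X),
  uniq s -> mu (cyl s x) = (m.+2%:R ^- size s)%:E.

(** A bijection that matches the cylinders over [s' N] with those over [s N],
    for an exhausting chain [s], preserves the uniform measure. *)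
Lemma preserves_uniform (f f' : Y -> Y) (s s' : nat -> seq T) :
  cancel f f' -> cancel f' f ->
  (forall N, uniq (s N)) -> (forall N, uniq (s' N)) ->
  (forall N, size (s' N) = size (s N)) ->
  (forall N N', (N <= N')%N -> {subset s N <= s N'}) ->
  (forall F : seq T, exists N, {subset F <= s N}) ->
  (forall N x y, {in s' N, x =1 y} <-> {in s N, f x =1 f y}) ->
  measurable_fun [set: Y] f /\ preserves mu f.
Proof.
move=> fK f'K us us' ss' ssub sF sE.
pose G : set (set Y) := [set U | [\/ U = set0, U = setT | exists N x, U = cyl (s N) x]].
have Gm : G `<=` @measurable _ Y.
  by move=> _ [->|->|[N [x ->]]] //; exact: measurable_cyl.
have GE : @measurable _ Y = <<s G >>.
  by apply: (generated_cyl sF) => // N x; apply: Or33; exists N, x.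
have f_cyl N x : f @^-1` cyl (s N) x = cyl (s' N) (f' x).
  apply/seteqP; split=> y /=.
    by move=> yx; apply/sE => t ts; rewrite f'K; exact: yx.
  by move=> /sE yx t ts; rewrite yx // f'K.
have fm : measurable_fun [set: Y] f.
  apply: (measurability G GE) => _ [_ [->|->|[N [x ->]]] <-]; rewrite setTI.
  - by rewrite preimage_set0.
  - by rewrite preimage_setT.
  - by rewrite f_cyl; exact: measurable_cyl.
split=> //; pose fmm := isMeasurableFun.Build _ _ _ _ f fm.
pose fM : {mfun Y >-> Y} := HB.pack f fmm.
have GI : setI_closed G.
  have GI0 N N' x y : (N <= N')%N -> G (cyl (s N) x `&` cyl (s N') y).
    move=> NN'; have [->|/set0P[z [zx zy]]] :=
      eqVneq (cyl (s N) x `&` cyl (s N') y) set0; first exact: Or31.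
    apply: Or33; exists N', z; apply/seteqP; split=> u /=.
      by move=> [ux uy] t ts; rewrite uy // zy.
    move=> uz; split=> t ts; first by rewrite uz ?zx //; exact: ssub ts.
    by rewrite uz // zy.
  move=> A A' [->|->|[N [x ->]]] [->|->|[N' [x' ->]]];
    rewrite ?set0I ?setI0 ?setTI ?setIT;
    do ?[exact: Or31|exact: Or32|by apply: Or33; do 2!eexists].
  have [|/ltnW] := leqP N N' => NN'; first exact: GI0.
  by rewrite setIC; exact: GI0.
move=> A mA.
apply: (measure_unique G (fun=> setT) GE GI _ _ (distribution mu fM) mu) => //.
- by move=> _; exact: Or32.
- by rewrite bigcup_const //; exists 0%N.
- move=> _ [->|->|[N [x ->]]]; rewrite /= /distribution /pushforward /=.
  + by rewrite preimage_set0.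
  + by rewrite preimage_setT.
  + by rewrite f_cyl !mu_cyl // ss'.
- by move=> _; apply: (le_lt_trans (probability_le1 _ measurableT)); rewrite ltry.
Qed.
End Preserves.
End ConfigMeasure.

(** * The transformation of digit sequences *)

(** The block in position [p] of a sequence [u] consists of the digits [u p] and
    [u p.+1], and its value is the integer with these digits. *)
Section Blocks.
Variable m : nat.
Let M := m.+2.
Local Notation D := 'I_m.+2.
Local Notation sq := (nat -> D).
Implicit Types (u v : sq) (o : bool) (p l : nat).

Definition block_val p u : nat := (u p * M + u p.+1)%N.

(** The sequence [u] with the block in position [p] replaced by the digits of
    [c]. *)
Definition set_block p (c : nat) u : sq := fun n =>
  if n == p then inord (c %/ M) else if n == p.+1 then inord (c %% M) else u n.

(** The block in position [p] is the first nonzero block of [u] among those in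
    positions of the parity [o], and no nonzero digit precedes it. For [o = true]
    there is no such block when [u 0] is nonzero. *)
Definition first_block o p u : Prop :=
  [/\ odd p = o, forall n, (n < p)%N -> u n = ord0 & (0 < block_val p u)%N].

(** Apply [phi] to the value of the first block of parity [o], if there is one. *)
Definition rewrite_block (phi : nat -> nat) o u : sq :=
  if pselect (exists p, first_block o p u) is left P then
    let p := projT1 (cid P) in set_block p (phi (block_val p u)) u
  else u.

Lemma block_val_lt p u : (block_val p u < M ^ 2)%N.
Proof. by have := ltn_ord (u p); have := ltn_ord (u p.+1); rewrite /block_val /M; nia. Qed.

Lemma set_block_val p c u : (c < M ^ 2)%N -> block_val p (set_block p c u) = c.
Proof.
move=> cM; rewrite /block_val /set_block eqxx (gtn_eqF (ltnSn p)) eqxx.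
rewrite !inordK ?ltn_mod // -?divn_eq // ltn_divLR // -expnS //.
Qed.

Lemma set_block_id p u : set_block p (block_val p u) u = u.
Proof.
apply/funext => n; rewrite /set_block /block_val.
case: eqP => [->|_].
  by apply/ord_inj; rewrite divnMDl // divn_small ?addn0 ?inordK.
case: eqP => [->|//].
by apply/ord_inj; rewrite modnMDl modn_small ?inordK.
Qed.

Lemma set_blockK p c c' u : set_block p c (set_block p c' u) = set_block p c u.
Proof.
apply/funext => n; rewrite /set_block.
by case: eqP => // _; case: eqP.
Qed.

Lemma first_block_set o p c u : (0 < c < M ^ 2)%N ->
  first_block o p u -> first_block o p (set_block p c u).
Proof.
move=> /andP[c0 cM] [po pu _]; split=> // [n np|]; last by rewrite set_block_val.
by rewrite /set_block !ltn_eqF ?pu // ltnW.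
Qed.

Lemma first_block_uniq o p p' u :
  first_block o p u -> first_block o p' u -> p = p'.
Proof.
have half q q' : first_block o q u -> first_block o q' u -> ~ (q < q')%N.
  move=> [qo _ q0] [q'o q'u _] qq'.
  have q1q' : (q.+1 < q')%N.
    by rewrite ltn_neqAle qq' andbT; apply/eqP => E; move: q'o; rewrite -E /= qo; case: (o).
  by move: q0; rewrite /block_val !q'u.
by move=> h h'; have [/half|/half|//] := ltngtP p p'; case; rewrite ?h.
Qed.

Section Rewrite.
Variable phi : nat -> nat.

Lemma rewrite_blockE o p u : first_block o p u ->
  rewrite_block phi o u = set_block p (phi (block_val p u)) u.
Proof.
move=> pu; rewrite /rewrite_block; case: pselect => [P|[]]; last by exists p.
by case: cid => q /= qu; rewrite (first_block_uniq qu pu).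
Qed.

Lemma rewrite_block_id o u :
  ~ (exists p, first_block o p u) -> rewrite_block phi o u = u.
Proof. by rewrite /rewrite_block; case: pselect. Qed.

Lemma first_block_prefix o p K u v : (forall n, (n < K)%N -> u n = v n) ->
  odd K = o -> (p < K)%N -> first_block o p u -> first_block o p v.
Proof.
move=> uv Ko pK [po pu p0].
have p1K : (p.+1 < K)%N.
  by rewrite ltn_neqAle pK andbT; apply/eqP => E; move: Ko; rewrite -E /= po; case: (o).
split=> // [n np|]; first by rewrite -uv ?pu // (ltn_trans np).
by rewrite /block_val -!uv.
Qed.

(** A prefix of the image is determined by the prefix of the same length of the
    sequence, if this length has the parity of the blocks, so that no block
    straddles its end. *)
Lemma rewrite_block_prefix o K u v : odd K = o ->
  (forall n, (n < K)%N -> u n = v n) ->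
  forall n, (n < K)%N -> rewrite_block phi o u n = rewrite_block phi o v n.
Proof.
move=> Ko uv n nK.
have [[p [pK pu]]|nu] := pselect (exists p, (p < K)%N /\ first_block o p u).
  have pv := first_block_prefix uv Ko pK pu.
  rewrite (rewrite_blockE pu) (rewrite_blockE pv) /set_block.
  have p1K : (p.+1 < K)%N.
    rewrite ltn_neqAle pK andbT; apply/eqP => E.
    by case: pu => po _ _; move: Ko; rewrite -E /= po; case: (o).
  have -> : block_val p u = block_val p v by rewrite /block_val !uv.
  by case: eqP => // _; case: eqP => // _; exact: uv.
have id_below w : ~ (exists p, (p < K)%N /\ first_block o p w) ->
    rewrite_block phi o w n = w n.
  move=> nw; have [[p pw]|/rewrite_block_id ->//] :=
    pselect (exists p, first_block o p w).
  have Kp : (K <= p)%N by rewrite leqNgt; apply/negP => pK; apply: nw; exists p.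
  have np := leq_trans nK Kp.
  by rewrite (rewrite_blockE pw) /set_block !ltn_eqF // ltnW.
rewrite !id_below ?uv // => -[p [pK pv]]; apply: nu; exists p; split=> //.
exact: (first_block_prefix (fun k kK => esym (uv k kK)) Ko pK pv).
Qed.
End Rewrite.

Lemma rewrite_blockK (phi psi : nat -> nat) o :
  (forall c, (0 < c < M ^ 2)%N -> (0 < phi c < M ^ 2)%N /\ psi (phi c) = c) ->
  cancel (rewrite_block phi o) (rewrite_block psi o).
Proof.
move=> phiP u; have [[p pu]|nu] := pselect (exists p, first_block o p u); last first.
  by rewrite (rewrite_block_id _ nu) rewrite_block_id.
have [_ _ p0] := pu; have [|cM E] := phiP (block_val p u).
  by rewrite p0 block_val_lt.
rewrite (rewrite_blockE phi pu) (rewrite_blockE psi (first_block_set cM pu)).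
have /andP[_ cM'] := cM; by rewrite set_block_val // E set_blockK set_block_id.
Qed.

(** The cyclic successor and predecessor on the integers from [1] to
    [M ^ 2 - 1]. *)
Definition block_succ (c : nat) : nat := if c.+1 == (M ^ 2)%N then 1%N else c.+1.
Definition block_pred (c : nat) : nat := if c == 1%N then (M ^ 2).-1 else c.-1.

Lemma block_succK c : (0 < c < M ^ 2)%N ->
  (0 < block_succ c < M ^ 2)%N /\ block_pred (block_succ c) = c.
Proof.
have M2 : (3 < M ^ 2)%N by rewrite /M; nia.
rewrite /block_succ /block_pred; move: (M ^ 2)%N M2 => K K3 /andP[c0 cK].
by case: eqP => E; case: eqP => E'; lia.
Qed.

Lemma block_predK c : (0 < c < M ^ 2)%N ->
  (0 < block_pred c < M ^ 2)%N /\ block_succ (block_pred c) = c.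
Proof.
have M2 : (3 < M ^ 2)%N by rewrite /M; nia.
rewrite /block_succ /block_pred; move: (M ^ 2)%N M2 => K K3 /andP[c0 cK].
by case: (c =P 1%N) => E; case: eqP => E'; lia.
Qed.

(** The first nonzero digit of [u] is in position [l]. *)
Definition leading l u : Prop := (forall n, (n < l)%N -> u n = ord0) /\ u l != ord0.

Lemma leading_uniq l l' u : leading l u -> leading l' u -> l = l'.
Proof.
move=> [lu l0] [l'u l'0].
case: (ltngtP l l') => // [/l'u E|/lu E].
  by rewrite E eqxx in l0.
by rewrite E eqxx in l'0.
Qed.

Lemma exists_leading u : (exists n, u n != ord0) -> exists l, leading l u.
Proof.
move=> P; exists (ex_minn P); case: ex_minnP => l l0 lmin; split=> // n nl.
by apply/eqP; apply: contraTT nl => /lmin; rewrite leqNgt.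
Qed.

(** The rank of a sequence: the position of its first nonzero digit and, for equal
    positions, the value of the block there; by convention the zero sequence
    has rank [0]. *)
Definition block_rank u : nat :=
  if pselect (exists l, leading l u) is left P then
    let l := projT1 (cid P) in (l * M ^ 2 + block_val l u)%N
  else 0%N.

Lemma block_rankE l u : leading l u ->
  block_rank u = (l * M ^ 2 + block_val l u)%N.
Proof.
move=> lu; rewrite /block_rank; case: pselect => [P|[]]; last by exists l.
by case: cid => l' /= l'u; rewrite (leading_uniq l'u lu).
Qed.

(** The first nonzero digit is in a position of parity [o]. *)
Definition leading_parity o u : Prop := exists2 l, odd l = o & leading l u.

Lemma leading_first_block o u : leading_parity o u -> exists p, first_block o p u.
Proof.
move=> [l lo [lu l0]]; exists l; split=> //.
rewrite /block_val; move: l0; rewrite -val_eqE /= => l0.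
by rewrite addn_gt0 muln_gt0 lt0n l0.
Qed.

(** The first nonzero digit is the first digit of the block exactly when the value
    of the block is at least [M]. *)
Lemma first_block_leading o p u : first_block o p u ->
  leading (if (M <= block_val p u)%N then p else p.+1) u.
Proof.
move=> [_ pu p0]; move: p0; rewrite /block_val.
have uM := ltn_ord (u p.+1); case: ifP => [Mp _|Mp p0].
  split=> //; apply/eqP => E; move: Mp; rewrite E mul0n add0n leqNgt.
  by rewrite uM.
have up : u p = ord0.
  apply/ord_inj => /=; apply/eqP; apply: contraFT Mp; rewrite -lt0n => up.
  by apply: leq_trans (leq_addr _ _); rewrite leq_pmull.
split=> [n|]; first by rewrite ltnS leq_eqVlt => /predU1P[->|/pu].
apply/eqP => E; move: p0; rewrite up E /=.
by rewrite mul0n.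
Qed.

Lemma iter_rewrite_block phi o p u j : first_block o p u ->
  (forall c, (0 < c < M ^ 2)%N -> (0 < phi c < M ^ 2)%N) ->
  let w := iter j (rewrite_block phi o) u in
  first_block o p w /\ block_val p w = iter j phi (block_val p u).
Proof.
move=> pu phiM; elim: j => [|j [pw wE]] //=.
have cM : (0 < phi (iter j phi (block_val p u)) < M ^ 2)%N.
  by apply: phiM; rewrite -wE block_val_lt; case: pw => _ _ ->.
rewrite (rewrite_blockE _ pw) wE; split; first exact: first_block_set.
by rewrite set_block_val //; case/andP: cM.
Qed.

Lemma iter_block_pred j c : (j < c)%N -> iter j block_pred c = (c - j)%N.
Proof.
elim: j => [|j IH] jc; first by rewrite subn0.
rewrite iterS IH ?(ltnW jc) // /block_pred; case: eqP; lia.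
Qed.

(** Stepping back fewer than [M] times decreases the rank, unless it leads to a
    first nonzero digit of the other parity. *)
Lemma block_rank_iter_pred o j u : (exists n, u n != ord0) -> (0 < j < M)%N ->
  leading_parity o (iter j (rewrite_block block_pred o) u) ->
  (block_rank (iter j (rewrite_block block_pred o) u) < block_rank u)%N.
Proof.
move=> u0 /andP[j0 jM] wo; set w := iter _ _ _ in wo *.
have [[p pu]|nu] := pselect (exists p, first_block o p u); last first.
  have wu : w = u by rewrite /w; elim: (j) => //= i ->; exact: rewrite_block_id.
  by case: nu; rewrite -wu; exact: leading_first_block.
have [pw wE] := iter_rewrite_block j pu (fun c cM => (block_predK cM).1).
rewrite -/w in pw wE.
have wl := first_block_leading pw; have ul := first_block_leading pu.
have po : odd p = o by case: pu.
move: wl; case: ifP => Mw wl; last first.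
  case: wo => l lo /(leading_uniq wl) lE.
  by move: lo; rewrite -lE /= po; case: (o).
(* In the first case both points have their first nonzero digit in position
   [p], and the block of [w] has the value of that of [u] minus [j]; in the
   second case the first nonzero digit of [u] is in position [p.+1]. *)
rewrite (block_rankE wl) (block_rankE ul); case: ifP => Mu.
  rewrite ltn_add2l wE iter_block_pred; last exact: leq_trans Mu.
  by have := leq_trans jM Mu; lia.
apply: (@leq_trans (p.+1 * M ^ 2)%N); last exact: leq_addr.
by rewrite mulSn addnC ltn_add2r block_val_lt.
Qed.
End Blocks.

(** * Orbit relations of countable groups *)

Section CountableActions.
Variables (R : realType) (d : measure_display) (X : measurableType d).
Variable mu : probability X R.
Variables (G : groupType) (act : G -> X -> X).
Hypothesis diagX : measurable [set xy : X * X | xy.1 = xy.2].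
Hypothesis countG : countable [set: G].
Hypothesis actP : is_action act.
Hypothesis act_meas : forall g, measurable_fun [set: X] (act g).

Lemma measurable_eq_fun d' (Z : measurableType d') (f g : Z -> X) :
  measurable_fun [set: Z] f -> measurable_fun [set: Z] g ->
  measurable [set z | f z = g z].
Proof.
move=> fm gm; have := measurable_fun_pair fm gm measurableT diagX.
by rewrite setTI.
Qed.

Lemma measurable_graph (U : set X) (f : X -> X) : measurable U ->
  measurable_fun [set: X] f ->
  measurable [set xy : X * X | U xy.1 /\ f xy.1 = xy.2].
Proof.
move=> mU fm; apply: measurableI.
  by have := @measurable_fst _ _ X X measurableT U mU; rewrite setTI.
apply: measurable_eq_fun; last exact: measurable_snd.
exact: measurableT_comp fm (@measurable_fst _ _ X X).
Qed.

Lemma measurable_orbit_relation (H : set G) :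
  measurable (orbit_relation act H).
Proof.
have -> : orbit_relation act H = \bigcup_g [set xy : X * X |
    (if `[< H g >] then setT else set0) xy.1 /\ act g xy.1 = xy.2].
  apply/seteqP; split=> [[x y] [g Hg /= gx]|[x y] [g _ /= []]].
    by exists g => //=; rewrite asboolT.
  by case: asboolP => // Hg _ gx; exists g.
apply: countable_bigcupT_measurable => // g; apply: measurable_graph => //.
by case: ifP.
Qed.

Lemma borel_orbit_relation (H : set G) : is_subgroup H ->
  borel_equiv_relation (orbit_relation act H).
Proof.
move=> Hs; split; first exact: orbit_relation_equiv.
exact: measurable_orbit_relation.
Qed.

Lemma measurable_kept_path (e : bool -> G) p (Pick : bool -> set X) u :
  (forall i, measurable (Pick i)) -> measurable [set x | kept_path e act p Pick u x].
Proof.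
move=> mP; elim: u => [|s u IH] /=.
  by rewrite (_ : [set _ | True] = setT) //; apply/seteqP; split.
apply: measurableI => //.
have pre g (U : set X) : measurable U -> measurable [set x | U (act g x)].
  by move=> mU; have := act_meas g measurableT mU; rewrite setTI.
have pk i : measurable [set x | picked e act p Pick i x].
  by case: i; exact: (pre _ (Pick _)).
apply: (pre _ [set x | kept_letter e act p Pick s x]); apply: measurableC.
case: s => i [] /=; last exact: pk.
exact: (pre _ [set x | picked e act p Pick i x]).
Qed.

Lemma borel_kept_relation (e : bool -> G) p (Pick : bool -> set X) :
  (forall i, measurable (Pick i)) ->
  borel_equiv_relation (kept_relation e act p Pick).
Proof.
move=> mP; split; first exact: kept_relation_equiv.
have -> : kept_relation e act p Pick = \bigcup_u [set xy : X * X |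
    kept_path e act p Pick u xy.1 /\ act (word_eval e u) xy.1 = xy.2].
  by apply/seteqP; split=> [[x y] [u ku ux]|[x y] [u _ [ku ux]]]; exists u.
apply: countable_bigcupT_measurable => [|u]; first exact: (countableP (T := word bool)).
by apply: measurable_graph => //; exact: measurable_kept_path.
Qed.

(** An element of the full group is pieced together from countably many group
    elements, each of which preserves the measure. *)
Lemma orbit_relation_measure_preserving :
  (forall g, preserves mu (act g)) ->
  measure_preserving_relation mu (orbit_relation act [set: G]).
Proof.
move=> act_mu f [f' [fK f'K fm f'm]] fE A mA.
have [c c_inj] : exists c : G -> nat, injective c.
  have /countable_injP[c c_inj] := countG.
  by exists c => g h; apply: c_inj; rewrite inE.
pose F n : set X := [set x | exists2 g, c g = n & act g x = f x].
have gF n : (exists g, c g = n) \/ F n = set0.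
  have [?|ng] := pselect (exists g, c g = n); first by left.
  by right; apply/seteqP; split=> // x [g gn _]; case: ng; exists g.
have Fm n : measurable (F n).
  have [[g gn]|->//] := gF n.
  have -> : F n = [set x | act g x = f x].
    apply/seteqP; split=> [x [h hn]|x gx]; last by exists g.
    by rewrite (c_inj h g) // hn.
  exact: measurable_eq_fun.
have Fcov : \bigcup_n F n = setT.
  apply/seteqP; split=> // x _; have [g _ gx] := fE x.
  by exists (c g) => //; exists g.
pose B n := f @^-1` A `&` seqDU F n.
have fpre U : measurable U -> measurable (f @^-1` U).
  by move=> mU; have := fm measurableT U mU; rewrite setTI.
have f'pre U : measurable U -> measurable (f' @^-1` U).
  by move=> mU; have := f'm measurableT U mU; rewrite setTI.
have Bm n : measurable (B n).
  by apply: measurableI; [exact: fpre | exact: seqDU_measurable].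
have Btriv : trivIset setT B.
  apply/trivIsetP => i j _ _ ij; rewrite /B setIACA setIid.
  by have /trivIsetP -> // := trivIset_seqDU F; rewrite setI0.
have BU : \bigcup_n B n = f @^-1` A.
  by rewrite -setI_bigcupr -seqDU_bigcup_eq Fcov setIT.
have f'B n : mu (f' @^-1` B n) = mu (B n).
  have [[g gn]|F0] := gF n; last first.
    have -> : B n = set0.
      by apply/seteqP; split=> // x [_]; rewrite /seqDU F0 => -[].
    by rewrite preimage_set0.
  rewrite -[RHS](act_mu g^-1%g) //; congr (mu _); apply/seteqP.
  have Bg x : B n x -> act g x = f x.
    by move=> [_ [[h hn] hx _]]; rewrite (c_inj g h) // gn.
  split=> y /= yB.
    by rewrite -(f'K y) -(Bg _ yB) (actK actP).
  have := Bg _ yB; rewrite (actVK actP) => yE.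
  by rewrite {1}yE fK.
have f'BU : \bigcup_n f' @^-1` B n = A.
  rewrite -preimage_bigcup BU; apply/seteqP.
  by split=> y /=; rewrite f'K.
rewrite -BU -[in RHS]f'BU !measure_bigcup //.
- apply: eq_eseriesr => n _; exact/esym/f'B.
- by move=> n _; exact: f'pre.
- apply/trivIsetP => i j _ _ ij; rewrite -preimage_setI.
  by have /trivIsetP -> // := Btriv; rewrite preimage_set0.
Qed.
End CountableActions.

(** * The action *)

Lemma measure_eq0_exp (R : realType) d (X : measurableType d)
    (mu : {measure set X -> \bar R}) (m : nat) (A : set X) :
  (forall n, (mu A <= (m.+2%:R ^- n)%:E)%E) -> mu A = 0%E.
Proof.
move=> muA; apply/eqP; rewrite eq_le measure_ge0 andbT.
apply/lee_addgt0Pr => eps eps0; rewrite add0e.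
apply: le_trans (muA (Num.truncn eps^-1).+1) _; rewrite lee_fin.
rewrite -[leRHS]invrK lef_pV2 ?posrE ?exprn_gt0 ?ltr0n ?invr_gt0 //.
apply: le_trans (ltW (truncnS_gt _)) _; rewrite -natrX ler_nat.
exact/ltnW/ltn_expl.
Qed.

Section Coincidence.
Variables (R : realType) (m : nat) (T : choiceType) (code : T -> nat).
Hypothesis code_inj : injective code.
Local Notation Y := (config_borel R m code).
Variable mu : probability Y R.
Hypothesis mu_cyl : forall (s : seq T) (x : Y),
  uniq s -> mu (cyl s x) = (m.+2%:R ^- size s)%:E.

Lemma measurable_coincidence (t t' : nat -> T) n :
  measurable [set x : Y | forall k, (k < n)%N -> x (t k) = x (t' k)].
Proof.
have -> : [set x : Y | forall k, (k < n)%N -> x (t k) = x (t' k)] =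
    \bigcap_(k in `I_n) \bigcup_(d in [set: 'I_m.+2])
      ([set x : Y | x (t k) == d] `&` [set x : Y | x (t' k) == d]).
  apply/seteqP; split=> x /=.
    by move=> tt' k kn; exists (x (t k)) => //; split; rewrite /= ?tt'.
  by move=> xk k kn; have [c _ [/= /eqP -> /eqP ->]] := xk k kn.
apply: fin_bigcap_measurable => // k _.
apply: fin_bigcup_measurable => [|c _]; first exact: finite_finset.
by apply: measurableI; exact: (measurable_coord code_inj _ (pred1 c)).
Qed.

(** Distinct coordinates are independent, so [n] disjoint pairs of coordinates
    coincide with probability [M ^- n]. *)
Lemma coincidence_le (t t' : nat -> T) n :
  injective t -> injective t' -> (forall k k', t k != t' k') ->
  (mu [set x : Y | forall k, (k < n)%N -> x (t k) = x (t' k)]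
    <= (m.+2%:R ^- n)%:E)%E.
Proof.
move=> t_inj t'_inj tt'.
pose ts := [seq t k | k <- iota 0 n]; pose ts' := [seq t' k | k <- iota 0 n].
have us : uniq (ts ++ ts').
  rewrite cat_uniq !map_inj_uniq // !iota_uniq /= andbT /=.
  apply/hasPn => _ /mapP[k _ ->]; apply/negP => /mapP[k' _ E].
  by have := tt' k' k; rewrite E eqxx.
pose F := {ffun 'I_n -> 'I_m.+2}.
pose pt (c : F) : Y := fun u =>
  if pselect (exists k : 'I_n, u = t k \/ u = t' k) is left P
  then c (projT1 (cid P)) else ord0.
have ptE c (k : 'I_n) u : u = t k \/ u = t' k -> pt c u = c k.
  move=> uk; rewrite /pt; case: pselect => [P|[]]; last by exists k.
  case: cid => k' /= uk'; congr (c _); apply/ord_inj.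
  case: uk uk' => -> [] E.
  - by apply/esym/t_inj.
  - by case/eqP: (tt' k k').
  - by case/eqP: (tt' k' k).
  - by apply/esym/t'_inj.
pose A (i : nat) : set Y := if insub i is Some j then
  cyl (ts ++ ts') (pt (enum_val (j : 'I_#|F|))) else set0.
have Am i : measurable (A i).
  by rewrite /A; case: insub => // j; exact: measurable_cyl.
have Asub : [set x : Y | forall k, (k < n)%N -> x (t k) = x (t' k)]
    `<=` \big[setU/set0]_(i < #|F|) A i.
  move=> x /= xt; rewrite -bigcup_mkord.
  exists (enum_rank [ffun k : 'I_n => x (t k)] : 'I_#|F|); first exact: ltn_ord.
  rewrite /A valK enum_rankK => u; rewrite mem_cat => /orP[] /mapP[k].
    rewrite mem_iota /= add0n => kn ->.
    by rewrite (ptE _ (Ordinal kn)) ?ffunE; [|left].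
  rewrite mem_iota /= add0n => kn ->.
  by rewrite (ptE _ (Ordinal kn)) ?ffunE /= ?xt //; right.
apply: (le_trans (le_measure _ _ _ Asub)).
- by rewrite inE; exact: measurable_coincidence.
- by rewrite inE; apply: bigsetU_measurable.
apply: (le_trans (Boole_inequality mu (fun i _ => Am i))).
rewrite (eq_bigr (fun=> (m.+2%:R ^- (n + n) : R)%:E)); last first.
  move=> i _; rewrite /A valK; have := mu_cyl (pt (enum_val i)) us.
  by rewrite size_cat !size_map size_iota => <-.
rewrite sumEFin sumr_const card_ord card_ffun !card_ord lee_fin.
rewrite -[X in X <= _]mulr_natl natrX exprD invfM mulrA divff ?mul1r //.
Qed.
End Coincidence.

Section Model.
Variables (R : realType) (G : groupType) (e : bool -> G) (m : nat).
Hypothesis eF : free_basis e.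

(** The indices in [nat] carry the digit sequence that determines the picks; the
    group acts by translation on the second factor of [nat * G]. Infinitely many
    copies of [G] provide independent coordinates at which a fixed point of [g]
    must have equal digits. *)
Definition index_set : choiceType := (nat + nat * G)%type.
Local Notation T := index_set.

(** An injective enumeration of the indices; group elements are encoded by their
    reduced words. *)
Definition index_code (t : T) : nat :=
  match t with
  | inl n => pickle (inl n : nat + nat * word bool)%type
  | inr (k, h) => pickle (inr (k, word_of eF h) : nat + nat * word bool)%type
  end.

Lemma index_code_inj : injective index_code.
Proof.
move=> [n|[k h]] [n'|[k' h']] /(pcan_inj pickleK) // => [[->] //|[->]].
by move=> /(congr1 (word_eval e)); rewrite !word_ofK => ->.
Qed.

Local Notation Y := (config_borel R m index_code).
Implicit Types x y : Y.

Definition digit_seq x : nat -> 'I_m.+2 := fun n => x (inl n).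

(** Rewrite a block of the digit sequence by [phi] and shift the other digits by
    [g]. *)
Definition twist (phi : nat -> nat) (o : bool) (g : G) x : Y := fun t =>
  match t with
  | inl n => rewrite_block phi o (digit_seq x) n
  | inr (k, h) => x (inr (k, g^-1 * h)%g)
  end.

Lemma twistK phi psi o g :
  (forall c, (0 < c < m.+2 ^ 2)%N -> (0 < phi c < m.+2 ^ 2)%N /\ psi (phi c) = c) ->
  cancel (twist phi o g) (twist psi o g^-1%g).
Proof.
move=> phiK x; apply/funext => -[n|[k h]] /=; last by rewrite invgK mulKg.
exact: (congr1 (fun u => u n) (rewrite_blockK o phiK (digit_seq x))).
Qed.

Lemma twistVK phi psi o g :
  (forall c, (0 < c < m.+2 ^ 2)%N -> (0 < phi c < m.+2 ^ 2)%N /\ psi (phi c) = c) ->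
  cancel (twist phi o g^-1%g) (twist psi o g).
Proof. by move=> phiP x; have := twistK o g^-1%g phiP x; rewrite invgK. Qed.

Let step i := twist (block_succ m) i (e i).
Let step' i := twist (block_pred m) i (e i)^-1%g.

Lemma model_stepK i : cancel (step i) (step' i).
Proof. exact/twistK/block_succK. Qed.

Lemma model_stepVK i : cancel (step' i) (step i).
Proof.
exact/twistVK/block_predK.
Qed.

(** The action of [G] for which [e i] applies the cyclic successor to the first
    block of parity [i]. *)
Definition model_act : G -> Y -> Y := free_act eF step step'.

Lemma model_actP : is_action model_act.
Proof. exact (free_act_is_action eF model_stepK model_stepVK). Qed.

Lemma model_act_basis i x : model_act (e i) x = step i x.
Proof. exact (free_act_basis eF model_stepK model_stepVK i x). Qed.

Lemma model_act_basisV i x : model_act (e i)^-1%g x = step' i x.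
Proof.
by rewrite -{1}(model_stepVK i x) -model_act_basis (actK model_actP).
Qed.

(** Induction on words: it suffices that a property is stable under left
    multiplication by letters. *)
Lemma group_letter_ind (P : G -> Prop) : P 1%g ->
  (forall i g, P g -> P (e i * g)%g /\ P ((e i)^-1 * g)%g) -> forall g, P g.
Proof.
move=> P1 PM g; rewrite -(word_ofK eF g).
elim: (word_of eF g) => [|[i b] u IH]; first by rewrite word_eval_nil.
by rewrite word_eval_cons; have [] := PM i _ IH; rewrite /letter_eval; case: b.
Qed.

Lemma model_act_inr g x k h :
  model_act g x (inr (k, h)) = x (inr (k, g^-1 * h)%g).
Proof.
move: g h; apply: group_letter_ind => [h|i g IH].
  by rewrite (act1x model_actP) invg1 mul1g.
split=> h; rewrite (actM model_actP).
  by rewrite model_act_basis /= IH invgM mulgA.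
by rewrite model_act_basisV /= IH invgM invgK mulgA.
Qed.

Lemma digit_seq_pred i j x :
  digit_seq (model_act (e i ^- j)%g x) =
  iter j (rewrite_block (block_pred m) i) (digit_seq x).
Proof.
elim: j => [|j IH].
  by rewrite expg0 invg1 (act1x model_actP).
rewrite expgSr invgM (actM model_actP) model_act_basisV /=.
by rewrite -IH.
Qed.

(** The digit sequence of [x] is not the zero sequence. *)
Definition nonzero x : Prop := exists n, digit_seq x n != ord0.

Lemma rewrite_block_zero phi o x : ~ nonzero x ->
  rewrite_block phi o (digit_seq x) = digit_seq x.
Proof.
move=> x0; apply: rewrite_block_id => -[p [_ _ p0]]; apply: x0.
have [xp|xp] := eqVneq (digit_seq x p) ord0; last by exists p.
by exists p.+1; apply/eqP => E; move: p0; rewrite /block_val xp E.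
Qed.

Lemma nonzero_act g x : nonzero x -> nonzero (model_act g x).
Proof.
have zero : forall g x, ~ nonzero x -> ~ nonzero (model_act g x).
  apply: group_letter_ind => [y|i h IH]; first by rewrite (act1x model_actP).
  have z phi o k y : ~ nonzero y -> ~ nonzero (twist phi o k y).
    by move=> y0 [n]; rewrite /digit_seq /= rewrite_block_zero // => yn; apply: y0; exists n.
  split=> y y0; rewrite (actM model_actP) ?model_act_basis ?model_act_basisV;
    exact/z/IH.
move=> x0; apply: contrapT => /(zero g^-1%g).
by rewrite (actK model_actP).
Qed.

(** The set of the points that pick [e i]. *)
Definition model_pick (i : bool) : set Y :=
  [set x | leading_parity i (digit_seq x)].

Lemma model_pickE x : nonzero x <-> model_pick false x \/ model_pick true x.
Proof.
split=> [/exists_leading[l lx]|].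
  by case: (boolP (odd l)) => [ol|/negPf el]; [right | left]; exists l.
by move=> [] [l _ [_ l0]]; exists l.
Qed.

Lemma model_pickI x : model_pick false x -> ~ model_pick true x.
Proof.
move=> [l ol lx] [l' ol' l'x]; move: ol ol'.
by rewrite (leading_uniq lx l'x) => ->.
Qed.

Lemma model_pick_rank i x j :
  model_pick false x \/ model_pick true x -> (0 < j < m.+2)%N ->
  model_pick i (model_act (e i ^- j)%g x) ->
  (block_rank (digit_seq (model_act (e i ^- j)%g x)) <
   block_rank (digit_seq x))%N.
Proof.
move=> /model_pickE x0 jm; rewrite /model_pick /= digit_seq_pred.
exact: block_rank_iter_pred.
Qed.

Lemma measurable_model_pick i : measurable (model_pick i).
Proof.
pose z n : set Y := [set x | x (inl n) == ord0].
have zm n : measurable (z n).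
  exact: (measurable_coord index_code_inj (inl n) (pred1 ord0)).
have -> : model_pick i =
    \bigcup_(l in [set l | odd l = i]) ((\bigcap_(n in `I_l) z n) `\` z l).
  apply/seteqP; split=> x.
    move=> [l li [lx l0]]; exists l => //; split; last exact/negP.
    by move=> n /lx /= E; apply/eqP.
  move=> [l li [lx /negP l0]]; exists l => //; split=> // n nl.
  exact/eqP/(lx n).
apply: bigcup_measurable => l _; apply: measurableD => //.
exact: fin_bigcap_measurable.
Qed.

Variable mu : probability Y R.
Hypothesis mu_cyl : forall (s : seq T) (x : Y),
  uniq s -> mu (cyl s x) = (m.+2%:R ^- size s)%:E.

Lemma twist_preserves phi psi o g :
  (forall c, (0 < c < m.+2 ^ 2)%N -> (0 < phi c < m.+2 ^ 2)%N /\ psi (phi c) = c) ->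
  (forall c, (0 < c < m.+2 ^ 2)%N -> (0 < psi c < m.+2 ^ 2)%N /\ phi (psi c) = c) ->
  measurable_fun [set: Y] (twist phi o g) /\ preserves mu (twist phi o g).
Proof.
move=> phiP psiP.
(* The cylinders over [s N] prescribe the first [N.*2 + o] digits of the sequence,
   a length of the parity of the blocks, and finitely many of the other
   digits; translation by [g] turns the latter into those of [s' N]. *)
have tK := twistK o g phiP.
have tVK := twistVK o g psiP.
pose pair_code (kh : nat * G) := index_code (inr kh).
have pair_code_inj : injective pair_code.
  by move=> kh kh' /index_code_inj [].
pose W N := undup (window pair_code N).
have WE N kh : (kh \in W N) = (pair_code kh < N)%N.
  by rewrite mem_undup mem_window.
pose I N : seq T := [seq inl n | n <- iota 0 (N.*2 + o)].
have IE N n : (inl n \in I N) = (n < N.*2 + o)%N.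
  by rewrite mem_map ?mem_iota //; move=> ? ? [].
have IrE N kh : (inr kh \in I N) = false by apply/mapP => -[].
pose s N : seq T := I N ++ [seq inr kh | kh <- W N].
pose s' N : seq T := I N ++ [seq inr (kh.1, g^-1 * kh.2)%g | kh <- W N].
have inr_inj : injective (inr : nat * G -> T) by move=> ? ? [].
have shift_inj : injective (fun kh : nat * G => inr (kh.1, g^-1 * kh.2)%g : T).
  by move=> [k h] [k' h'] [-> /mulgI ->].
have uI N : uniq (I N) by rewrite map_inj_uniq ?iota_uniq //; move=> ? ? [].
have sE N t : (t \in s N) =
    match t with inl n => n < N.*2 + o | inr kh => pair_code kh < N end%N.
  rewrite mem_cat; case: t => [n|kh].
    by rewrite IE; case: mapP => [[]//|_]; rewrite orbF.
  by rewrite IrE mem_map // WE.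
apply: (preserves_uniform index_code_inj mu_cyl tK tVK (s := s) (s' := s')).
- move=> N; rewrite cat_uniq uI map_inj_uniq // undup_uniq andbT /=.
  by apply/hasPn => _ /mapP[kh _ ->]; rewrite IrE.
- move=> N; rewrite cat_uniq uI map_inj_uniq // undup_uniq andbT /=.
  by apply/hasPn => _ /mapP[kh _ ->]; rewrite IrE.
- by move=> N; rewrite !size_cat !size_map.
- move=> N N' NN' t; rewrite !sE; case: t => [n|kh] h.
    by apply: leq_trans h _; rewrite leq_add2r leq_double.
  exact: leq_trans h NN'.
- move=> F; pose b (t : T) := match t with inl n => n | inr kh => pair_code kh end.
  exists (\max_(t <- F) b t).+1 => t tF; rewrite sE.
  have : (b t <= \max_(t <- F) b t)%N by exact: leq_bigmax_seq.
  case: t tF => [n|kh] tF /=; rewrite /b.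
    by move=> h; rewrite ltn_addr // -addnn addSn ltnS (leq_trans h) // leq_addr.
  by rewrite ltnS.
- move=> N x y; have odd_len : odd (N.*2 + o) = o by rewrite oddD odd_double oddb.
  split=> [xy t|xy t].
    rewrite sE; case: t => [n nN|[k h] kN] /=.
      apply: (rewrite_block_prefix phi odd_len) => // n' n'N.
      by apply: xy; rewrite mem_cat IE n'N.
    apply: xy; rewrite mem_cat; apply/orP; right; apply/mapP.
    by exists (k, h); rewrite // WE.
  have xyt u : u \in s N -> twist phi o g x u = twist phi o g y u by exact: xy.
  rewrite mem_cat => /orP[/mapP[n]|/mapP[[k h]]].
    rewrite mem_iota /= add0n => nN ->.
    have pre := rewrite_block_prefix psi odd_len
      (u := digit_seq (twist phi o g x)) (v := digit_seq (twist phi o g y)).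
    have [] : digit_seq (twist psi o g^-1%g (twist phi o g x)) n =
              digit_seq (twist psi o g^-1%g (twist phi o g y)) n.
      by apply: pre nN => n' n'N; apply: xyt; rewrite sE.
    by rewrite !tK.
  by rewrite WE => kN ->; have := xyt (inr (k, h)); rewrite sE => /(_ kN).
Qed.

Lemma model_act_preserves g :
  measurable_fun [set: Y] (model_act g) /\ preserves mu (model_act g).
Proof.
move: g; apply: group_letter_ind => [|i g [gm g_mu]].
  rewrite (_ : model_act 1%g = id); first by split; [exact: measurable_id|].
  by apply/funext => x; rewrite (act1x model_actP).
have comp f : measurable_fun [set: Y] f /\ preserves mu f ->
    measurable_fun [set: Y] (f \o model_act g) /\ preserves mu (f \o model_act g).
  move=> [fm f_mu]; split; first exact: measurableT_comp.
  move=> A mA; rewrite comp_preimage g_mu ?f_mu //.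
  by have := fm measurableT A mA; rewrite setTI.
split.
  rewrite (_ : model_act (e i * g)%g = step i \o model_act g).
    exact/comp/(twist_preserves _ _ (@block_succK m) (@block_predK m)).
  by apply/funext => x; rewrite (actM model_actP) model_act_basis.
rewrite (_ : model_act ((e i)^-1 * g)%g = step' i \o model_act g).
  exact/comp/(twist_preserves _ _ (@block_predK m) (@block_succK m)).
by apply/funext => x; rewrite (actM model_actP) model_act_basisV.
Qed.

Lemma countable_group : countable [set: G].
Proof.
apply/countable_injP; exists (fun g => pickle (word_of eF g)).
move=> g h _ _ /(pcan_inj pickleK) /(congr1 (word_eval e)).
by rewrite !word_ofK.
Qed.

Lemma model_act_pmp : pmp_action mu model_act.
Proof.
split=> [|g]; first exact: model_actP.
split; last exact: (model_act_preserves g).2.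
exists (model_act g^-1%g); split.
- exact: actK model_actP g.
- exact: actVK model_actP g.
- exact: (model_act_preserves g).1.
- exact: (model_act_preserves g^-1%g).1.
Qed.

(** The set of the fixed points of [g]. *)
Definition fixed (g : G) : set Y := [set x | model_act g x = x].

Lemma measurable_fixed g : measurable (fixed g).
Proof.
apply: (measurable_eq index_code_inj); first exact: (model_act_preserves g).1.
exact: measurable_id.
Qed.

Lemma fixed_null g : g != 1%g -> mu (fixed g) = 0%E.
Proof.
move=> g1; apply: (measure_eq0_exp (m := m)) => n.
pose t k : T := inr (k, 1%g); pose t' k : T := inr (k, g^-1%g).
apply: (@le_trans _ _ (mu [set x : Y | forall k, (k < n)%N -> x (t k) = x (t' k)])).
  apply: le_measure; rewrite ?inE; [exact: measurable_fixed| |].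
    exact: (measurable_coincidence index_code_inj).
  move=> x /= gx k _; rewrite -{1}gx /t model_act_inr mulg1 //.
apply: (coincidence_le index_code_inj mu_cyl); do ?by move=> ? ? [].
move=> k k'; apply/eqP => -[_ E]; move: g1.
by rewrite -(invgK g) -E invg1 eqxx.
Qed.

Lemma zero_null : mu [set x | ~ nonzero x] = 0%E.
Proof.
apply: (measure_eq0_exp (m := m)) => n; pose s : seq T := [seq inl k | k <- iota 0 n].
have us : uniq s by rewrite map_inj_uniq ?iota_uniq //; move=> ? ? [].
have := mu_cyl (fun=> ord0) us; rewrite size_map size_iota => <-.
apply: le_measure; rewrite ?inE.
- rewrite (_ : [set x | ~ nonzero x] =
    ~` (model_pick false `|` model_pick true)).
    by apply: measurableC; apply: measurableU; exact: measurable_model_pick.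
  by apply/seteqP; split=> x /=; rewrite model_pickE.
- exact: (measurable_cyl index_code_inj).
- move=> x x0 _ /mapP[k _ ->]; apply: contrapT => /eqP xk; apply: x0.
  by exists k.
Qed.

(** The points with a nontrivial stabilizer. *)
Definition nonfree_set : set Y :=
  [set x | exists2 g : G, g != 1%g & model_act g x = x].

Lemma measurable_nonfree : measurable nonfree_set.
Proof.
have -> : nonfree_set = \bigcup_g (if g == 1%g then set0 else fixed g).
  apply/seteqP; split=> x [g].
    by move=> g1 gx; exists g => //; rewrite (negPf g1).
  by move=> _; case: eqP => // /eqP g1 gx; exists g.
apply: countable_bigcupT_measurable; first exact: countable_group.
by move=> g; case: ifP => // _; exact: measurable_fixed.
Qed.

Lemma model_act_free : free_action mu model_act.
Proof.
have /countable_injP[c c_inj] := countable_group.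
pose F n : set Y := [set x | exists g, [/\ g != 1%g, c g = n & fixed g x]].
have : mu.-negligible (\bigcup_n F n).
  apply: negligible_bigcup => n.
  have [[g [gn g1]]|ng] := pselect (exists g, c g = n /\ g != 1%g).
    exists (fixed g); split; [exact: measurable_fixed | exact: fixed_null |].
    by move=> x [h [_ hn hx]]; rewrite (c_inj g h) ?inE // gn.
  rewrite (_ : F n = set0); first exact: negligible_set0.
  by apply/seteqP; split=> // x [g [g1 gn _]]; apply: ng; exists g.
by apply: negligibleS => x [g g1 gx]; exists (c g) => //; exists g.
Qed.

(** The conull invariant set on which the two relations are orthogonal. *)
Definition good_set : set Y := [set x | nonzero x] `\` nonfree_set.

Lemma measurable_nonzero : measurable [set x | nonzero x].
Proof.
rewrite (_ : [set x | nonzero x] = model_pick false `|` model_pick true).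
  by apply: measurableU; exact: measurable_model_pick.
by apply/seteqP; split=> x /=; rewrite model_pickE.
Qed.

Lemma measurable_good : measurable good_set.
Proof. exact: measurableD measurable_nonzero measurable_nonfree. Qed.

Lemma good_set1 : mu good_set = 1%E.
Proof.
have muC : mu (~` good_set) = 0%E.
  apply: measure_negligible; first by apply: measurableC; exact: measurable_good.
  apply: (@negligibleS _ _ _ _ ([set x | ~ nonzero x] `|` nonfree_set)).
    by move=> x; rewrite /good_set setCD => -[nx|]; [left | right].
  apply: negligibleU; last exact: model_act_free.
  apply/negligibleP; last exact: zero_null.
  exact: measurableC measurable_nonzero.
rewrite -(setCK good_set) probability_setC ?muC ?sube0 //.
by apply: measurableC; exact: measurable_good.
Qed.

Lemma good_set_act g x : good_set x -> good_set (model_act g x).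
Proof.
move=> [x0 xg]; split; first exact: nonzero_act.
move=> [h h1 hx]; apply: xg; exists (g^-1 * h * g)%g.
  apply: contra h1 => /eqP E.
  have : (g * (g^-1 * h * g) * g^-1 = 1)%g by rewrite E mulg1 mulgV.
  by rewrite !mulgA mulgV mul1g mulgK => ->.
by rewrite !(actM model_actP) hx (actK model_actP).
Qed.
End Model.

(** * Conclusion *)

Theorem measure_free_factor_nat (R : realType) (G : groupType) (e : bool -> G)
    (p q : nat) : free_basis e ->
  measure_free_factor R (cyclic_subgroup (e false ^+ p.+1 * e true ^+ q.+1)%g).
Proof.
move=> eF; split; first exact: is_subgroup_cyclic.
pose m := maxn p q.
have c_inj := @index_code_inj G e eF.
have [mu mu_cyl] := exists_uniform_measure R m c_inj.
pose act := @model_act R G e m eF.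
pose Pick := @model_pick R G e m eF.
have actP : is_action act := model_actP R m eF.
have act_meas g : measurable_fun setT (act g) := (model_act_preserves mu_cyl g).1.
have act_mu g : preserves mu (act g) := (model_act_preserves mu_cyl g).2.
have diagY : measurable [set xy : config_borel R m (index_code eF) *
    config_borel R m (index_code eF) | xy.1 = xy.2].
  by apply: (measurable_eq c_inj); [exact: measurable_fst | exact: measurable_snd].
have countG := countable_group eF.
have Pick_rank i y j : Pick false y \/ Pick true y ->
    (0 < j <= if i then q else p)%N -> Pick i (act (e i ^- j)%g y) ->
    (block_rank (digit_seq (act (e i ^- j)%g y)) < block_rank (digit_seq y))%N.
  move=> yP /andP[j0 jpq]; apply: model_pick_rank => //; rewrite j0 /=.
  by rewrite ltnS leqW // (leq_trans jpq) // /m; case: i {jpq};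
    rewrite ?leq_maxl ?leq_maxr.
exists _, (config_borel R m (index_code eF)), mu, act, (kept_relation e act p Pick).
split.
- exact: config_standard_borel.
- exact: model_act_pmp.
- exact: model_act_free.
split.
- split; first exact: borel_orbit_relation.
  exact: orbit_relation_measure_preserving.
- apply: borel_orbit_relation => //; exact: is_subgroup_cyclic.
- by apply: borel_kept_relation => // i; exact: measurable_model_pick.
- exact: (orbit_relation_generated eF actP (@model_pickI R G e m eF) Pick_rank).
exists (@good_set R G e m eF); split.
- exact: (measurable_good mu_cyl).
- exact: (good_set1 mu_cyl).
apply: (kept_relation_orthogonal eF actP (@model_pickI R G e m eF) Pick_rank).
- exact: good_set_act.
- by move=> x [/model_pickE].
- move=> g x [_ xg] gx; apply/eqP; apply: contrapT => g1; apply: xg.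
  by exists g => //; apply/negP.
Qed.

Theorem theorem5p2 (R : realType) (G : groupType) (a b : G)
    (Gfree : free_basis2 a b) (k n : int) (hk : k != 0) (hn : n != 0) :
  measure_free_factor R (cyclic_subgroup (expgz a k * expgz b n)%g).
Proof.
pose neg (z : int) := if z is Negz _ then true else false.
pose flip (i : bool) := neg (if i then n else k).
pose e (i : bool) := if i then b else a.
pose e' (i : bool) := if flip i then ((e i)^-1)%g else e i.
have e'F : free_basis e' by apply: (free_basis_map (flip := flip) _ Gfree).
have expE i z : z != 0 -> neg z = flip i ->
    expgz (e i) z = (e' i ^+ (`|z|%N).-1.+1)%g.
  rewrite /e' => z0 <-; rewrite prednK ?absz_gt0 //.
  by case: z {z0} => z; rewrite ?expVgn.
rewrite -[a]/(e false) -[b]/(e true) (expE false) // (expE true) //.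
exact: measure_free_factor_nat.
Qed.
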